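(* Let $f : B(0,R) \to \mathbb{H}$ be a regular function. If $U$ is a circular open subset of $B(0,R)$, then $f(U)$ is open.
   Context: $\mathbb{H}$ is the skew field of real quaternions, with the usual norm $|\cdot|$, and $B(0,R)=\{q\in\mathbb{H}:|q|<R\}$. Let $\mathbb{S}=\{q\in\mathbb{H}:q^2=-1\}$ be the 2-sphere of imaginary units and, for $I\in\mathbb{S}$, let $L_I=\mathbb{R}+I\mathbb{R}$. A real differentiable function $f:\Omega\to\mathbb{H}$ on a domain $\Omega\subseteq\mathbb{H}$ is called regular (Cullen-regular) if for every $I\in\mathbb{S}$ the restriction $f_I$ of $f$ to $\Omega\cap L_I$ satisfies $\frac12\left(\frac{\partial}{\partial x}+I\frac{\partial}{\partial y}\right)f_I(x+Iy)=0$ at every point $x+Iy$ of $\Omega\cap L_I$ ($x,y\in\mathbb{R}$). For $x,y\in\mathbb{R}$ write $x+y\mathbb{S}=\{x+yI:I\in\mathbb{S}\}$. A set $U\subseteq\mathbb{H}$ is called circular if, for all $x+yI\in U$ with $x,y\in\mathbb{R}$, $y>0$ and $I\in\mathbb{S}$, the whole 2-sphere $x+y\mathbb{S}$ is contained in $U$.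
   Formalization: The regular function f is additionally assumed to be nonconstant on B(0,R); for a constant f and any nonempty U the image f(U) is a single point, which is not open. *)

(* Defs.v *)
(* Stdlib reals with Coquelicot. *)
From Stdlib Require Import Reals Lra.
From Coquelicot Require Import Coquelicot.
Open Scope R_scope.

(* (a, b, c, d) stands for a + b i + c j + d k.  As a product type, quat carries
   Coquelicot's product topology and product structure of normed module over R;
   Qnorm_norm checks that the norm of the latter is the usual one. *)
Definition quat : Type := (R * R * R * R)%type.

Definition Qmult (p q : quat) : quat :=
  let '(a1, b1, c1, d1) := p in
  let '(a2, b2, c2, d2) := q in
  (a1 * a2 - b1 * b2 - c1 * c2 - d1 * d2,
   a1 * b2 + b1 * a2 + c1 * d2 - d1 * c2,
   a1 * c2 - b1 * d2 + c1 * a2 + d1 * b2,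
   a1 * d2 + b1 * c2 - c1 * b2 + d1 * a2).

Definition Qreal (x : R) : quat := (x, 0, 0, 0).

Definition Qnorm (q : quat) : R :=
  let '(a, b, c, d) := q in sqrt (a ^ 2 + b ^ 2 + c ^ 2 + d ^ 2).

Lemma Qnorm_norm (q : quat) : norm q = Qnorm q.
Proof.
destruct q as [[[a b] c] d].
unfold Qnorm, norm; simpl; unfold prod_norm, norm; simpl; unfold prod_norm, norm; simpl.
unfold prod_norm, norm; simpl; unfold abs; simpl.
assert (Habs : forall x, Rabs x * Rabs x = x * x)
  by (intros x; rewrite <- Rabs_mult; apply Rabs_pos_eq; nra).
f_equal; rewrite !Rmult_1_r.
rewrite (sqrt_sqrt (_ + Rabs c * _)); rewrite ?sqrt_sqrt, !Habs; nra.
Qed.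

(* The open ball B(0, r). *)
Definition Qball0 (r : R) (q : quat) : Prop := Qnorm q < r.

Definition imag_unit (I : quat) : Prop := Qmult I I = Qreal (-1).

(* x + y I *)
Definition slice (I : quat) (x y : R) : quat :=
  plus (Qreal x) (Qmult (Qreal y) I).

(* A function on Omega is represented by a total function, whose values outside
   Omega are irrelevant: Omega is meant to be open, so that the derivatives below
   only see the values of f on Omega.  The partial derivatives exist by real
   differentiability, hence the existential asserts only the equation. *)
Definition regular (Omega : quat -> Prop) (f : quat -> quat) : Prop :=
  (forall q : quat, Omega q -> ex_filterdiff (K := R_AbsRing) f (locally q)) /\
  (forall I : quat, imag_unit I ->
   forall x y : R, Omega (slice I x y) ->
   exists fx fy : quat,
     is_derive (fun t : R => f (slice I t y)) x fx /\
     is_derive (fun t : R => f (slice I x t)) y fy /\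
     Qmult (Qreal (1 / 2)) (plus fx (Qmult I fy)) = Qreal 0).

Definition circular (U : quat -> Prop) : Prop :=
  forall (x y : R) (I : quat), 0 < y -> imag_unit I -> U (slice I x y) ->
  forall J : quat, imag_unit J -> U (slice J x y).

Definition image (f : quat -> quat) (U : quat -> Prop) : quat -> Prop :=
  fun w => exists q : quat, U q /\ f q = w.

Definition nonconstant_on (Omega : quat -> Prop) (f : quat -> quat) : Prop :=
  exists p q : quat, Omega p /\ Omega q /\ f p <> f q.

(* Main.v *)
Require Import Defs.
From Stdlib Require Import Reals Lra Lia ClassicalEpsilon Wf_nat.
From Coquelicot Require Import Coquelicot.
Open Scope R_scope.

(** The question is moved to one complex variable.  A regular function has the form
    [f (x + y I) = b (x, y) + I c (x, y)] with [b] and [c] independent of the imaginary unit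
    [I] (lemma [representation]), and the components [b_m + i c_m] of its stem are holomorphic
    functions of [x + i y].  A quaternion [w] is a value of [f] on the sphere of [x + i y] if
    and only if [b - w = - I c] for some unit [I], that is, if and only if [b - w] and [c] are
    orthogonal and of equal length.  These two real equations are one complex equation,
    namely the vanishing of the holomorphic function [stem_norm f w], the sum of the squares
    [(b_m + i c_m - w_m)^2] (lemma [stem_norm_eq_0]).

    Since [U] is circular, the image of [U] is therefore the set of the [w] for which
    [stem_norm f w] has a zero in a plane open set, and the theorem becomes a statement of
    Hurwitz type: a zero [z0] of [stem_norm f w0] persists for [w] near [w0].  As [f] is not
    constant, the zero is isolated ([stem_norm_nonzero], [isolated_zeros]), so the function
    is bounded below on a small circle around [z0]; for [w] near [w0] this remains so on the
    circle while the value at [z0] is small, and [minimum_modulus] produces a zero inside.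

    The complex analysis is developed from complex differentiability alone, since the
    definition of regularity gives no continuity of the derivatives.  Goursat's theorem for
    rectangles, applied in logarithmic coordinates, shows that circle integrals do not
    depend on the radius ([circ_annulus_closed]), whence the mean value property, which
    tolerates one point where the function is only continuous.  Applied to a difference
    quotient it gives Cauchy's formula, from which Taylor expansion with remainder, isolated
    zeros and the identity theorem follow. *)

(** * Complex differentiability *)

Lemma locally_Cmod (z : C) (P : C -> Prop) :
  locally z P <-> exists del, 0 < del /\ forall u : C, Cmod (u - z) < del -> P u.
Proof.
split.
- intros [e He]; exists e; split; [apply cond_pos|].
  intros u Hu; apply He; apply C_NormedModule_mixin_compat1; exact Hu.
- intros [d [Hd H]].
  assert (Hs : 0 < sqrt 2) by (apply sqrt_lt_R0; lra).
  exists (mkposreal (d / sqrt 2) (Rdiv_lt_0_compat _ _ Hd Hs)).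
  intros u Hu; apply H.
  replace d with (sqrt 2 * (d / sqrt 2)) by (field; lra).
  exact (C_NormedModule_mixin_compat2 z u _ Hu).
Qed.

Lemma continuous_Cmod (g : C -> C) (z : C) :
  continuous g z <->
  forall eps, 0 < eps -> exists del, 0 < del /\
    forall u : C, Cmod (u - z) < del -> Cmod (g u - g z) < eps.
Proof.
split.
- intros H eps Heps.
  apply (locally_Cmod z (fun u => Cmod (g u - g z) < eps)).
  apply (H (fun v => Cmod (v - g z) < eps)).
  apply locally_Cmod; exists eps; auto.
- intros H P HP.
  apply locally_Cmod in HP; destruct HP as [e [He HP]].
  destruct (H e He) as [d [Hd Hu]].
  apply locally_Cmod; exists d; split; auto.
Qed.

(** Complex differentiability as real differentiability with a complex-linear differential,
    so that it composes with the real differentiability of regular functions. *)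
Definition is_Cderive (g : C -> C) (z d : C) : Prop :=
  filterdiff (K := R_AbsRing) (U := C_R_NormedModule) (V := C_R_NormedModule)
    g (locally z) (fun h : C => (d * h)%C).

Definition holo (g : C -> C) (z : C) : Prop := exists d : C, is_Cderive g z d.

Lemma is_linear_Cmult (d : C) :
  is_linear (K := R_AbsRing) (U := C_R_NormedModule) (V := C_R_NormedModule)
    (fun h : C => (d * h)%C).
Proof.
split.
- intros x y; change (d * (x + y) = d * x + d * y)%C; ring.
- intros k x.
  destruct d as [d1 d2], x as [x1 x2].
  unfold scal; simpl; unfold prod_scal, Cmult, scal; simpl; unfold mult; simpl.
  f_equal; ring.
- exists (Cmod d + 1); split; [pose proof (Cmod_ge_0 d); lra|].
  intros x; rewrite <- !Cmod_norm, Cmod_mult.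
  pose proof (Cmod_ge_0 x); nra.
Qed.

Lemma is_Cderive_Cmod (g : C -> C) (z d : C) :
  is_Cderive g z d <->
  forall eps, 0 < eps -> exists del, 0 < del /\
    forall u : C, Cmod (u - z) < del ->
      Cmod (g u - g z - d * (u - z)) <= eps * Cmod (u - z).
Proof.
split.
- intros [_ H] eps Heps.
  apply (locally_Cmod z (fun u => Cmod (g u - g z - d * (u - z)) <= eps * Cmod (u - z))).
  generalize (H z (fun P HP => HP) (mkposreal eps Heps)).
  apply filter_imp; intros u Hu; rewrite !Cmod_norm; exact Hu.
- intros H; split; [apply is_linear_Cmult|].
  intros x Hx eps.
  assert (E : z = x) by (apply is_filter_lim_locally_unique; exact Hx).
  subst x.
  destruct (H eps (cond_pos eps)) as [del [Hdel Hu]].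
  apply locally_Cmod; exists del; split; auto.
  intros u Huz; rewrite <- !Cmod_norm; apply (Hu u Huz).
Qed.

Lemma holo_continuous (g : C -> C) (z : C) : holo g z -> continuous g z.
Proof.
intros [d H].
apply (filterdiff_continuous (K := R_AbsRing) (U := C_R_NormedModule) (V := C_R_NormedModule) g z).
eexists; exact H.
Qed.

Lemma holo_ext_loc (f g : C -> C) (z : C) :
  locally z (fun u => f u = g u) -> holo f z -> holo g z.
Proof.
intros He [d H]; exists d; unfold is_Cderive in *.
apply (filterdiff_ext_locally (K := R_AbsRing) (U := C_R_NormedModule) (V := C_R_NormedModule) f); auto.
Qed.

Lemma holo_const (c z : C) : holo (fun _ => c) z.
Proof.
exists 0%C; apply is_Cderive_Cmod; intros eps Heps; exists 1; split; [lra|].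
intros u _; replace (c - c - 0 * (u - z))%C with (RtoC 0) by ring.
rewrite Cmod_0; pose proof (Cmod_ge_0 (u - z)); nra.
Qed.

Lemma is_Cderive_id (z : C) : is_Cderive (fun u => u) z 1%C.
Proof.
apply is_Cderive_Cmod; intros eps Heps; exists 1; split; [lra|].
intros u _; replace (u - z - 1 * (u - z))%C with (RtoC 0) by ring.
rewrite Cmod_0; pose proof (Cmod_ge_0 (u - z)); nra.
Qed.

Lemma holo_id (z : C) : holo (fun u => u) z.
Proof. exists 1%C; apply is_Cderive_id. Qed.

Lemma holo_plus (f g : C -> C) (z : C) :
  holo f z -> holo g z -> holo (fun u => (f u + g u)%C) z.
Proof.
intros [df Hf] [dg Hg]; exists (df + dg)%C.
apply (filterdiff_ext_lin (K := R_AbsRing) (U := C_R_NormedModule) (V := C_R_NormedModule)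
  _ (fun h : C => (df * h + dg * h)%C)).
- apply (filterdiff_plus_fct (K := R_AbsRing) (U := C_R_NormedModule) (V := C_R_NormedModule)); auto.
- intros h; change (df * h + dg * h = (df + dg) * h :> C)%C; ring.
Qed.

Lemma is_Cderive_comp (f g : C -> C) (z df dg : C) :
  is_Cderive f (g z) df -> is_Cderive g z dg ->
  is_Cderive (fun u => f (g u)) z (df * dg)%C.
Proof.
intros Hf Hg.
apply (filterdiff_ext_lin (K := R_AbsRing) (U := C_R_NormedModule) (V := C_R_NormedModule)
  _ (fun h : C => (df * (dg * h))%C)).
- apply (filterdiff_comp' (K := R_AbsRing) (U := C_R_NormedModule) (V := C_R_NormedModule) (W := C_R_NormedModule)); auto.
- intros h; change (df * (dg * h) = df * dg * h :> C)%C; ring.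
Qed.

Lemma holo_comp (f g : C -> C) (z : C) :
  holo f (g z) -> holo g z -> holo (fun u => f (g u)) z.
Proof. intros [df Hf] [dg Hg]; eexists; eapply is_Cderive_comp; eauto. Qed.

Lemma holo_scal (c : C) (g : C -> C) (z : C) : holo g z -> holo (fun u => (c * g u)%C) z.
Proof.
apply (holo_comp (fun v => (c * v)%C)).
exists c; apply is_Cderive_Cmod; intros eps Heps; exists 1; split; [lra|].
intros u _; match goal with |- Cmod ?x <= _ => replace x with (RtoC 0) by ring end.
rewrite Cmod_0; pose proof (Cmod_ge_0 (u - g z)); nra.
Qed.

(** The form in which the elementary differentiability proofs below get by without little-o
    bookkeeping: a remainder of second order. *)
Lemma holo_quadratic_error (g : C -> C) (z d : C) (del K : R) :
  0 < del ->
  (forall u, Cmod (u - z) < del -> Cmod (g u - g z - d * (u - z)) <= K * Cmod (u - z) ^ 2) ->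
  holo g z.
Proof.
intros Hdel H; exists d; apply is_Cderive_Cmod; intros eps Heps.
set (K1 := Rabs K + 1).
assert (HK1 : 0 < K1) by (unfold K1; pose proof (Rabs_pos K); lra).
exists (Rmin del (eps / K1)); split.
- apply Rmin_pos; auto; apply Rdiv_lt_0_compat; lra.
- intros u Hu.
  eapply Rle_trans; [apply H; eapply Rlt_le_trans; [exact Hu|apply Rmin_l]|].
  assert (Hu2 : Cmod (u - z) < eps / K1) by (eapply Rlt_le_trans; [exact Hu|apply Rmin_r]).
  pose proof (Cmod_ge_0 (u - z)).
  assert (Hk : K1 * Cmod (u - z) <= eps).
  { apply Rmult_lt_compat_l with (r := K1) in Hu2; auto.
    replace (K1 * (eps / K1)) with eps in Hu2 by (field; lra); lra. }
  assert (K <= K1) by (unfold K1; pose proof (Rle_abs K); lra).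
  assert (K * Cmod (u - z) <= eps) by nra.
  replace (K * Cmod (u - z) ^ 2) with ((K * Cmod (u - z)) * Cmod (u - z)) by ring.
  apply Rmult_le_compat_r; auto.
Qed.

Lemma holo_sqr (z : C) : holo (fun u => (u * u)%C) z.
Proof.
apply (holo_quadratic_error _ _ (2 * z)%C 1 1); [lra|].
intros u _.
replace (u * u - z * z - 2 * z * (u - z))%C with ((u - z) * (u - z))%C by ring.
rewrite Cmod_mult; lra.
Qed.

Lemma holo_minus (f g : C -> C) (z : C) :
  holo f z -> holo g z -> holo (fun u => (f u - g u)%C) z.
Proof.
intros Hf Hg.
apply (holo_ext_loc (fun u => (f u + (-(1)) * g u)%C)).
- apply filter_forall; intros u; ring.
- apply holo_plus, holo_scal; auto.
Qed.

(** Polarisation reduces products to squares, hence to the chain rule. *)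
Lemma holo_mult (f g : C -> C) (z : C) :
  holo f z -> holo g z -> holo (fun u => (f u * g u)%C) z.
Proof.
intros Hf Hg.
apply (holo_ext_loc (fun u => (/ 4) * ((f u + g u) * (f u + g u) - (f u - g u) * (f u - g u)))%C).
- apply filter_forall; intros u; field.
- apply holo_scal, holo_minus.
  + apply (holo_comp (fun v => v * v)%C (fun u => (f u + g u)%C)); [apply holo_sqr|apply holo_plus; auto].
  + apply (holo_comp (fun v => v * v)%C (fun u => (f u - g u)%C)); [apply holo_sqr|apply holo_minus; auto].
Qed.

(** The remainder of [/ u] at [z] is [(u - z)^2 / (z^2 u)], and [u] stays away from 0. *)
Lemma holo_Cinv (z : C) : z <> 0%C -> holo Cinv z.
Proof.
intros Hz.
assert (Hm : 0 < Cmod z) by (apply Cmod_gt_0; auto).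
apply (holo_quadratic_error _ _ (- / (z * z))%C (Cmod z / 2) (2 / Cmod z ^ 3)); [lra|].
intros u Hu.
assert (Hmu : Cmod z / 2 < Cmod u).
{ pose proof (Cmod_triangle u (z - u)) as T.
  replace (u + (z - u))%C with z in T by ring.
  replace (z - u)%C with (- (u - z))%C in T by ring.
  rewrite Cmod_opp in T; lra. }
assert (Hu0 : u <> 0%C) by (apply Cmod_gt_0; lra).
replace (/ u - / z - - / (z * z) * (u - z))%C
  with ((u - z) * (u - z) * / (z * z * u))%C by (field; auto).
rewrite !Cmod_mult, Cmod_inv, !Cmod_mult by (repeat apply Cmult_neq_0; auto).
set (m := Cmod (u - z)) in *; set (a := Cmod z) in *; set (b := Cmod u) in *.
assert (0 <= m) by apply Cmod_ge_0.
assert (/ (a * a * b) <= 2 / a ^ 3).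
{ replace (2 / a ^ 3) with (/ (a * a * (a / 2))) by (field; lra).
  apply Rinv_le_contravar; [|apply Rmult_le_compat_l; nra].
  repeat apply Rmult_lt_0_compat; lra. }
replace (m ^ 2) with (m * m) by ring.
rewrite (Rmult_comm (2 / _)); apply Rmult_le_compat_l; nra.
Qed.

Lemma holo_inv (g : C -> C) (z : C) :
  holo g z -> g z <> 0%C -> holo (fun u => (/ g u)%C) z.
Proof. intros Hg Hz; apply (holo_comp Cinv g); auto; apply holo_Cinv; auto. Qed.

Lemma holo_div (f g : C -> C) (z : C) :
  holo f z -> holo g z -> g z <> 0%C -> holo (fun u => (f u / g u)%C) z.
Proof. intros; apply holo_mult; auto; apply holo_inv; auto. Qed.

(** The normed module structure is pinned because unification would pick the one over
    the complex numbers. *)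
Notation diff_at_C k z l := (filterdiff (K := R_AbsRing) (U := C_R_NormedModule)
  (V := R_NormedModule) k (locally (z : C)) l).

Lemma filterdiff_Cpair (u v lu lv : C -> R) (z : C) :
  diff_at_C u z lu -> diff_at_C v z lv ->
  filterdiff (K := R_AbsRing) (U := C_R_NormedModule) (V := C_R_NormedModule)
    (fun w : C => (u w, v w) : C) (locally z) (fun h : C => (lu h, lv h) : C).
Proof.
intros Hu Hv.
apply (filterdiff_comp_2 (K := R_AbsRing) (T := C_R_NormedModule) (U := R_NormedModule)
  (V := R_NormedModule) (W := C_R_NormedModule)
  (FF := filter_filter (ProperFilter := locally_filter (T := C_R_NormedModule) z))
  u v (fun x y : R => (x, y)) lu lv (fun x y : R => (x, y)) Hu Hv).
apply (filterdiff_linear (K := R_AbsRing) (U := prod_NormedModule R_AbsRing R_NormedModule R_NormedModule) (V := C_R_NormedModule)).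
apply (is_linear_prod (K := R_AbsRing)); [apply is_linear_fst|apply is_linear_snd].
Qed.

Lemma holo_of_cauchy_riemann (u v lu lv : C -> R) (z : C) :
  diff_at_C u z lu -> diff_at_C v z lv ->
  lu (1, 0) = lv (0, 1) -> lu (0, 1) = - lv (1, 0) -> holo (fun w => (u w, v w)) z.
Proof.
intros Hu Hv H1 H2; exists (lu (1, 0), lv (1, 0)).
apply (filterdiff_ext_lin (K := R_AbsRing) (U := C_R_NormedModule) (V := C_R_NormedModule)
  _ (fun h : C => (lu h, lv h) : C)); [apply filterdiff_Cpair; auto|].
assert (E : forall (l : C -> R) (h : C),
  is_linear (K := R_AbsRing) (U := C_R_NormedModule) (V := R_NormedModule) l ->
  l h = fst h * l (1, 0) + snd h * l (0, 1)).
{ intros l h Hl.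
  pose proof (linear_plus _ Hl (scal (V := C_R_NormedModule) (fst h) (1, 0))
    (scal (V := C_R_NormedModule) (snd h) (0, 1))) as P.
  rewrite !(linear_scal _ Hl) in P.
  refine (eq_trans _ P); f_equal; apply injective_projections;
    [change (fst h = fst h * 1 + snd h * 0)|change (snd h = fst h * 0 + snd h * 1)]; ring. }
intros h; pose proof (E lu h (proj1 Hu)) as Eu; pose proof (E lv h (proj1 Hv)) as Ev.
rewrite H2 in Eu; rewrite <- H1 in Ev.
change ((lu h, lv h) = ((lu (1, 0), lv (1, 0)) * h)%C).
rewrite Eu, Ev; apply injective_projections; simpl; ring.
Qed.

(** * Integrals of complex functions and Goursat's theorem *)

Definition CInt (f : R -> C) (a b : R) : C := RInt (V := C_R_CompleteNormedModule) f a b.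

Definition Ccont_on (f : R -> C) (a b : R) : Prop := forall t, a <= t <= b -> continuous f t.

Lemma is_CInt (f : R -> C) (a b : R) :
  a <= b -> Ccont_on f a b ->
  is_RInt (V := C_R_CompleteNormedModule) f a b (CInt f a b).
Proof.
intros Hab Hf; apply (RInt_correct (V := C_R_CompleteNormedModule)).
apply (ex_RInt_continuous (V := C_R_CompleteNormedModule)).
rewrite Rmin_left, Rmax_right by lra; exact Hf.
Qed.

Lemma CInt_unique (f : R -> C) (a b : R) (l : C) :
  is_RInt (V := C_R_CompleteNormedModule) f a b l -> CInt f a b = l.
Proof. apply (is_RInt_unique (V := C_R_CompleteNormedModule)). Qed.

Lemma CInt_ext (f g : R -> C) (a b : R) :
  a <= b -> (forall t, a <= t <= b -> f t = g t) -> CInt f a b = CInt g a b.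
Proof.
intros Hab H; apply (RInt_ext (V := C_R_CompleteNormedModule)).
rewrite Rmin_left, Rmax_right by lra; intros t Ht; apply H; lra.
Qed.

Lemma CInt_plus (f g : R -> C) (a b : R) :
  a <= b -> Ccont_on f a b -> Ccont_on g a b ->
  CInt (fun t => f t + g t)%C a b = (CInt f a b + CInt g a b)%C.
Proof.
intros Hab Hf Hg; apply CInt_unique.
apply (is_RInt_plus (V := C_R_CompleteNormedModule)); apply is_CInt; auto.
Qed.

Lemma CInt_minus (f g : R -> C) (a b : R) :
  a <= b -> Ccont_on f a b -> Ccont_on g a b ->
  CInt (fun t => f t - g t)%C a b = (CInt f a b - CInt g a b)%C.
Proof.
intros Hab Hf Hg; apply CInt_unique.
apply (is_RInt_minus (V := C_R_CompleteNormedModule)); apply is_CInt; auto.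
Qed.

Lemma CInt_const (c : C) (a b : R) : CInt (fun _ => c) a b = (RtoC (b - a) * c)%C.
Proof.
apply CInt_unique.
replace (RtoC (b - a) * c)%C with (scal (V := C_R_NormedModule) (b - a) c).
- apply (is_RInt_const (V := C_R_NormedModule)).
- destruct c as [c1 c2]; unfold scal; simpl; unfold prod_scal, scal, Cmult, RtoC; simpl; unfold mult; simpl.
  f_equal; ring.
Qed.

Lemma CInt_scal (c : C) (f : R -> C) (a b : R) :
  a <= b -> Ccont_on f a b ->
  CInt (fun t => c * f t)%C a b = (c * CInt f a b)%C.
Proof.
intros Hab Hf; apply CInt_unique.
pose proof (is_CInt f a b Hab Hf) as H.
destruct c as [c1 c2].
pose proof (is_RInt_fct_extend_fst (U := R_NormedModule) (V := R_NormedModule) _ _ _ _ H) as H1.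
pose proof (is_RInt_fct_extend_snd (U := R_NormedModule) (V := R_NormedModule) _ _ _ _ H) as H2.
apply (is_RInt_fct_extend_pair (U := R_NormedModule) (V := R_NormedModule)).
- apply (is_RInt_minus (V := R_NormedModule)); apply (is_RInt_scal (V := R_NormedModule)); auto.
- apply (is_RInt_plus (V := R_NormedModule)); apply (is_RInt_scal (V := R_NormedModule)); auto.
Qed.

Lemma CInt_Chasles (f : R -> C) (a m b : R) :
  a <= m <= b -> Ccont_on f a b -> CInt f a b = (CInt f a m + CInt f m b)%C.
Proof.
intros Hm Hf; apply CInt_unique.
apply (is_RInt_Chasles (V := C_R_CompleteNormedModule)) with m; apply is_CInt; try lra;
  intros t Ht; apply Hf; lra.
Qed.

Lemma CInt_Cmod_le (f : R -> C) (a b M : R) :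
  a <= b -> Ccont_on f a b -> (forall t, a <= t <= b -> Cmod (f t) <= M) ->
  Cmod (CInt f a b) <= (b - a) * M.
Proof.
intros Hab Hf HM; rewrite Cmod_norm.
apply (norm_RInt_le_const (V := C_R_NormedModule)) with f; auto.
- intros t Ht; rewrite <- Cmod_norm; auto.
- apply is_CInt; auto.
Qed.

Lemma Ccont_on_minus (f g : R -> C) (a b : R) :
  Ccont_on f a b -> Ccont_on g a b -> Ccont_on (fun t => f t - g t)%C a b.
Proof.
intros Hf Hg t Ht; apply (continuous_minus (V := C_R_NormedModule)); [apply Hf|apply Hg]; auto.
Qed.

Lemma Ccont_on_const (c : C) (a b : R) : Ccont_on (fun _ => c) a b.
Proof. intros t _; apply continuous_const. Qed.

Lemma continuous_horizontal (h : C -> C) (x y : R) :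
  continuous h (x, y) -> continuous (fun t => h (t, y)) x.
Proof.
intros H; apply (continuous_comp (fun t : R => (t, y)) h); auto.
apply (continuous_comp_2 (fun t : R => t) (fun _ => y) (fun a b => (a, b) : C));
  [apply continuous_id|apply continuous_const|].
apply (continuous_ext (fun z => z)); [intros []; reflexivity|apply continuous_id].
Qed.

Lemma continuous_vertical (h : C -> C) (x y : R) :
  continuous h (x, y) -> continuous (fun t => h (x, t)) y.
Proof.
intros H; apply (continuous_comp (fun t : R => (x, t)) h); auto.
apply (continuous_comp_2 (fun _ => x) (fun t : R => t) (fun a b => (a, b) : C));
  [apply continuous_const|apply continuous_id|].
apply (continuous_ext (fun z => z)); [intros []; reflexivity|apply continuous_id].
Qed.

Definition cont_rect (h : C -> C) (a b c d : R) : Prop :=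
  forall x y, a <= x <= b -> c <= y <= d -> continuous h (x, y).

(** The integral of [h(z) dz] along the boundary of the rectangle, with opposite sides
    paired: for an affine [h] both integrands are constant. *)
Definition rect_int (h : C -> C) (a b c d : R) : C :=
  (CInt (fun x => h (x, c) - h (x, d)) a b + Ci * CInt (fun y => h (b, y) - h (a, y)) c d)%C.

Lemma cont_rect_h (h : C -> C) (a b c d y : R) :
  cont_rect h a b c d -> c <= y <= d -> Ccont_on (fun x => h (x, y)) a b.
Proof. intros H Hy x Hx; apply continuous_horizontal; auto. Qed.

Lemma cont_rect_v (h : C -> C) (a b c d x : R) :
  cont_rect h a b c d -> a <= x <= b -> Ccont_on (fun y => h (x, y)) c d.
Proof. intros H Hy y Hx; apply continuous_vertical; auto. Qed.

Lemma cont_rect_sub (h : C -> C) (a b c d a' b' c' d' : R) :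
  cont_rect h a b c d ->
  a <= a' -> b' <= b -> c <= c' -> d' <= d -> cont_rect h a' b' c' d'.
Proof. intros H ? ? ? ? x y Hx Hy; apply H; lra. Qed.

Lemma rect_int_split_h (h : C -> C) (a m b c d : R) :
  a <= m <= b -> c <= d -> cont_rect h a b c d ->
  rect_int h a b c d = (rect_int h a m c d + rect_int h m b c d)%C.
Proof.
intros Hm Hcd H; unfold rect_int.
rewrite (CInt_Chasles _ a m b);
  [|auto|apply Ccont_on_minus; eapply cont_rect_h; eauto; lra].
rewrite !(CInt_minus (fun y => h (_, y))); try lra;
  try (eapply cont_rect_v; eauto; lra).
ring.
Qed.

Lemma rect_int_split_v (h : C -> C) (a b c m d : R) :
  a <= b -> c <= m <= d -> cont_rect h a b c d ->
  rect_int h a b c d = (rect_int h a b c m + rect_int h a b m d)%C.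
Proof.
intros Hab Hm H; unfold rect_int.
rewrite (CInt_Chasles _ c m d);
  [|auto|apply Ccont_on_minus; eapply cont_rect_v; eauto; lra].
rewrite !(CInt_minus (fun x => h (x, _))); try lra;
  try (eapply cont_rect_h; eauto; lra).
ring.
Qed.

(** An affine function contributes nothing, so only the deviation from it counts.  This is
    the estimate on small squares in Goursat's argument. *)
Lemma rect_int_affine_error (h : C -> C) (a b c d : R) (p al be : C) (M : R) :
  a <= b -> c <= d -> cont_rect h a b c d ->
  (forall x y, a <= x <= b -> c <= y <= d ->
     Cmod (h (x, y) - al - be * ((x, y) - p)) <= M) ->
  Cmod (rect_int h a b c d) <= 2 * M * ((b - a) + (d - c)).
Proof.
intros Hab Hcd H HM.
assert (Hd : forall u v k : C, Cmod u <= M -> Cmod v <= M -> k = (u - v)%C -> Cmod k <= 2 * M).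
{ intros u v k Hu Hv ->.
  unfold Cminus; pose proof (Cmod_triangle u (- v)) as T; rewrite Cmod_opp in T; lra. }
set (k1 := Cmult be (0, - (d - c))); set (k2 := (be * RtoC (b - a))%C).
assert (C1 : Ccont_on (fun x => h (x, c) - h (x, d))%C a b)
  by (apply Ccont_on_minus; eapply cont_rect_h; eauto; lra).
assert (C2 : Ccont_on (fun y => h (b, y) - h (a, y))%C c d)
  by (apply Ccont_on_minus; eapply cont_rect_v; eauto; lra).
assert (E : rect_int h a b c d =
  (CInt (fun x => (h (x, c) - h (x, d)) - k1) a b
   + Ci * CInt (fun y => (h (b, y) - h (a, y)) - k2) c d)%C).
{ rewrite (CInt_minus _ (fun _ => k1)), (CInt_minus _ (fun _ => k2)); auto using Ccont_on_const.
  rewrite !CInt_const; unfold rect_int, k1, k2, Ci.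
  match goal with |- (?A + ?B * ?D = _)%C => generalize A, D end.
  intros A D; destruct be, A, D; unfold RtoC, Cplus, Cminus, Cmult, Copp; simpl.
  f_equal; ring. }
rewrite E; eapply Rle_trans; [apply Cmod_triangle|].
rewrite Cmod_mult, Cmod_Ci, Rmult_1_l.
assert (B1 : Cmod (CInt (fun x => (h (x, c) - h (x, d)) - k1)%C a b) <= (b - a) * (2 * M)).
{ apply CInt_Cmod_le; auto using Ccont_on_minus, Ccont_on_const.
  intros x Hx; apply (Hd (h (x, c) - al - be * ((x, c) - p))%C (h (x, d) - al - be * ((x, d) - p))%C).
  - apply HM; lra.
  - apply HM; lra.
  - unfold k1; destruct be, al, (h (x, c)), (h (x, d)), p.
    unfold RtoC, Cplus, Cminus, Cmult, Copp; apply injective_projections; simpl; ring. }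
assert (B2 : Cmod (CInt (fun y => (h (b, y) - h (a, y)) - k2)%C c d) <= (d - c) * (2 * M)).
{ apply CInt_Cmod_le; auto using Ccont_on_minus, Ccont_on_const.
  intros y Hy; apply (Hd (h (b, y) - al - be * ((b, y) - p))%C (h (a, y) - al - be * ((a, y) - p))%C).
  - apply HM; lra.
  - apply HM; lra.
  - unfold k2; destruct be, al, (h (b, y)), (h (a, y)), p.
    unfold RtoC, Cplus, Cminus, Cmult, Copp; apply injective_projections; simpl; ring. }
lra.
Qed.
(** The point is the supremum of the left ends. *)
Lemma nested_halvings (x : nat -> R) (L : R) :
  0 <= L -> (forall n, x (S n) = x n \/ x (S n) = x n + L / 2 ^ (S n)) ->
  exists p, forall n, x n <= p <= x n + L / 2 ^ n.
Proof.
intros HL Hx.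
assert (Hpow : forall n, 0 < 2 ^ n) by (intros; apply pow_lt; lra).
assert (Hhalf : forall n, L / 2 ^ n = 2 * (L / 2 ^ S n)).
{ intros n; simpl; field; apply Rgt_not_eq, Hpow. }
assert (Hpos : forall n, 0 <= L / 2 ^ n).
{ intros n; apply Rdiv_le_0_compat; auto. }
assert (Hstep : forall n k, x n <= x (n + k)%nat /\ x (n + k)%nat + L / 2 ^ (n + k) <= x n + L / 2 ^ n).
{ intros n k; induction k as [|k IH]; [rewrite Nat.add_0_r; lra|].
  rewrite Nat.add_succ_r.
  pose proof (Hpos (S (n + k))); pose proof (Hhalf (n + k)%nat).
  destruct (Hx (n + k)%nat) as [E|E]; rewrite E; lra. }
destruct (completeness (fun r => exists n, r = x n)) as [p [Hp1 Hp2]].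
- exists (x O + L / 2 ^ 0); intros r [n ->].
  pose proof (Hstep O n); pose proof (Hpos n); simpl in *; lra.
- exists (x O); exists O; auto.
- exists p; intros n; split; [apply Hp1; exists n; auto|].
  apply Hp2; intros r [m ->].
  destruct (Nat.le_ge_cases n m) as [Hnm|Hnm].
  + replace m with (n + (m - n))%nat by lia.
    pose proof (Hstep n (m - n)%nat); pose proof (Hpos (n + (m - n))%nat); lra.
  + replace n with (m + (n - m))%nat by lia.
    pose proof (Hstep m (n - m)%nat); pose proof (Hpos (m + (n - m))%nat); lra.
Qed.

(** The pair [(x, y)] stands for the rectangle of generation [n], with sides [L / 2 ^ n] and
    [W / 2 ^ n], that has it as lower left corner.  Choosing a quarter at each generation gives
    nested halvings in both coordinates. *)
Lemma bisection_2d (P : nat -> R -> R -> Prop) (a c L W : R) :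
  0 <= L -> 0 <= W -> P O a c ->
  (forall n x y, P n x y -> exists x' y',
     (x' = x \/ x' = x + L / 2 ^ S n) /\ (y' = y \/ y' = y + W / 2 ^ S n) /\ P (S n) x' y') ->
  exists p q, forall n, exists x y,
    x <= p <= x + L / 2 ^ n /\ y <= q <= y + W / 2 ^ n /\ P n x y.
Proof.
intros HL HW H0 HS.
set (T := fun n => {z : R * R | P n (fst z) (snd z)}).
set (good := fun n (z z' : R * R) =>
  (fst z' = fst z \/ fst z' = fst z + L / 2 ^ S n) /\
  (snd z' = snd z \/ snd z' = snd z + W / 2 ^ S n) /\ P (S n) (fst z') (snd z')).
assert (step : forall n (z : T n), {z' : R * R | good n (proj1_sig z) z'}).
{ intros n [[x y] Hz]; apply constructive_indefinite_description.
  destruct (HS n x y Hz) as [x' [y' H']]; exists (x', y'); exact H'. }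
set (s := fix s n : T n := match n with
  | O => exist _ (a, c) H0
  | S m => exist _ (proj1_sig (step m (s m))) (proj2 (proj2 (proj2_sig (step m (s m)))))
  end).
destruct (nested_halvings (fun n => fst (proj1_sig (s n))) L HL) as [p Hp].
{ intros n; exact (proj1 (proj2_sig (step n (s n)))). }
destruct (nested_halvings (fun n => snd (proj1_sig (s n))) W HW) as [q Hq].
{ intros n; exact (proj1 (proj2 (proj2_sig (step n (s n))))). }
exists p, q; intros n; exists (fst (proj1_sig (s n))), (snd (proj1_sig (s n))).
split; [apply Hp|split; [apply Hq|exact (proj2_sig (s n))]].
Qed.

Lemma Cmod_le_Rabs (x y : R) : Cmod (x, y) <= Rabs x + Rabs y.
Proof.
unfold Cmod; simpl fst; simpl snd.
pose proof (Rabs_pos x); pose proof (Rabs_pos y).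
rewrite <- (sqrt_square (Rabs x + Rabs y)) by lra.
apply sqrt_le_1_alt; rewrite <- (pow2_abs x), <- (pow2_abs y); nra.
Qed.

(** If the integral had modulus [K > 0], bisection would give rectangles scaled
    by [1 / 2 ^ n] whose integrals are at least [K / 4 ^ n] and which shrink to a point; there
    complex differentiability makes the integral smaller than any given multiple of
    [1 / 4 ^ n].  No continuity of the derivative enters, which matters because regular
    functions are only assumed real differentiable. *)
Lemma goursat (h : C -> C) (a b c d : R) :
  a <= b -> c <= d ->
  (forall x y, a <= x <= b -> c <= y <= d -> holo h (x, y)) ->
  rect_int h a b c d = 0%C.
Proof.
intros Hab Hcd Hh.
assert (Hc : cont_rect h a b c d) by (intros x y Hx Hy; apply holo_continuous; auto).
apply Cmod_eq_0.
set (K := Cmod (rect_int h a b c d)).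
assert (HK0 : 0 <= K) by apply Cmod_ge_0.
destruct (Rle_lt_or_eq_dec 0 K HK0) as [HK|]; [exfalso|auto].
set (L := b - a); set (W := d - c).
assert (Hpow : forall n, 0 < 2 ^ n) by (intros; apply pow_lt; lra).
assert (Hhalf : forall X n, X / 2 ^ n = X / 2 ^ S n + X / 2 ^ S n).
{ intros X n; simpl; field; apply Rgt_not_eq, Hpow. }
assert (Hpos : forall X n, 0 <= X -> 0 <= X / 2 ^ n).
{ intros X n HX; apply Rdiv_le_0_compat; auto. }
set (P := fun n x y => a <= x /\ x + L / 2 ^ n <= b /\ c <= y /\ y + W / 2 ^ n <= d /\
   K <= 4 ^ n * Cmod (rect_int h x (x + L / 2 ^ n) y (y + W / 2 ^ n))).
assert (HL : 0 <= L) by (unfold L; lra).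
assert (HW : 0 <= W) by (unfold W; lra).
destruct (bisection_2d P a c L W HL HW) as [p [q Hpq]].
- unfold P; simpl; replace (L / 1) with L by field; replace (W / 1) with W by field.
  unfold L, W; replace (a + (b - a)) with b by ring; replace (c + (d - c)) with d by ring.
  fold K; lra.
- intros n x y (X1 & X2 & Y1 & Y2 & HP).
  rewrite (Hhalf L n) in X2, HP; rewrite (Hhalf W n) in Y2, HP.
  pose proof (Hpos L (S n) HL); pose proof (Hpos W (S n) HW).
  unfold P; set (l := L / 2 ^ S n) in *; set (w := W / 2 ^ S n) in *.
  assert (F : 0 < 4 ^ n) by (apply pow_lt; lra).
  (* one of the four quarters carries at least a quarter of the integral *)
  assert (E : rect_int h x (x + (l + l)) y (y + (w + w)) =
    (rect_int h x (x + l) y (y + w) + rect_int h x (x + l) (y + w) (y + w + w)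
     + (rect_int h (x + l) (x + l + l) y (y + w)
        + rect_int h (x + l) (x + l + l) (y + w) (y + w + w)))%C).
  { replace (x + (l + l)) with (x + l + l) by ring; replace (y + (w + w)) with (y + w + w) by ring.
    rewrite (rect_int_split_h h x (x + l)), 
      (rect_int_split_v h x _ y (y + w)), (rect_int_split_v h (x + l) _ y (y + w)); try lra; auto;
      eapply cont_rect_sub; eauto; lra. }
  rewrite E in HP.
  pose proof (Cmod_triangle
     (rect_int h x (x + l) y (y + w) + rect_int h x (x + l) (y + w) (y + w + w))
     (rect_int h (x + l) (x + l + l) y (y + w) + rect_int h (x + l) (x + l + l) (y + w) (y + w + w))) as T1.
  pose proof (Cmod_triangle (rect_int h x (x + l) y (y + w)) (rect_int h x (x + l) (y + w) (y + w + w))) as T2.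
  pose proof (Cmod_triangle (rect_int h (x + l) (x + l + l) y (y + w)) (rect_int h (x + l) (x + l + l) (y + w) (y + w + w))) as T3.
  change (4 ^ S n) with (4 * 4 ^ n).
  set (A1 := Cmod (rect_int h x (x + l) y (y + w))) in *.
  set (A2 := Cmod (rect_int h x (x + l) (y + w) (y + w + w))) in *.
  set (A3 := Cmod (rect_int h (x + l) (x + l + l) y (y + w))) in *.
  set (A4 := Cmod (rect_int h (x + l) (x + l + l) (y + w) (y + w + w))) in *.
  destruct (Rle_dec K (4 * 4 ^ n * A1)); [exists x, y; repeat split; auto; lra|].
  destruct (Rle_dec K (4 * 4 ^ n * A2)); [exists x, (y + w); repeat split; auto; lra|].
  destruct (Rle_dec K (4 * 4 ^ n * A3)); [exists (x + l), y; repeat split; auto; lra|].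
  destruct (Rle_dec K (4 * 4 ^ n * A4)); [exists (x + l), (y + w); repeat split; auto; lra|].
  exfalso; nra.
- assert (Hp : a <= p <= b /\ c <= q <= d).
  { destruct (Hpq O) as [x [y [Hx [Hy (X1 & X2 & Y1 & Y2 & _)]]]]; lra. }
  destruct (Hh p q) as [dh Hdh]; try tauto.
  (* with this [eps] the affine estimate on generation [n] stays below [K / 4 ^ n] *)
  set (S2 := L + W).
  set (eps := K / (4 * (S2 * S2 + 1))).
  assert (Heps : 0 < eps) by (apply Rdiv_lt_0_compat; nra).
  destruct (proj1 (is_Cderive_Cmod _ _ _) Hdh eps Heps) as [del [Hdel Herr]].
  destruct (pow_lt_1_zero (/ 2) ltac:(rewrite Rabs_pos_eq; lra) (del / (S2 + 1))) as [n Hn].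
  { apply Rdiv_lt_0_compat; unfold S2; lra. }
  specialize (Hn n (le_n n)).
  destruct (Hpq n) as [x [y [Hx [Hy (X1 & X2 & Y1 & Y2 & HP)]]]].
  set (D := S2 / 2 ^ n).
  assert (HD : L / 2 ^ n + W / 2 ^ n = D) by (unfold D, S2; field; apply Rgt_not_eq, Hpow).
  assert (HD0 : 0 <= D) by (apply Hpos; unfold S2; lra).
  assert (HDdel : D < del).
  { rewrite pow_inv, Rabs_pos_eq in Hn by (left; apply Rinv_0_lt_compat, Hpow).
    unfold D; assert (0 <= S2) by (unfold S2; lra).
    assert (0 < / 2 ^ n) by (apply Rinv_0_lt_compat, Hpow).
    assert ((S2 + 1) * / 2 ^ n < del).
    { apply Rmult_lt_compat_l with (r := S2 + 1) in Hn; [|lra].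
      replace ((S2 + 1) * (del / (S2 + 1))) with del in Hn by (field; lra); lra. }
    unfold Rdiv; nra. }
  assert (Hest : Cmod (rect_int h x (x + L / 2 ^ n) y (y + W / 2 ^ n)) <=
     2 * (eps * D) * ((x + L / 2 ^ n - x) + (y + W / 2 ^ n - y))).
  { pose proof (Hpos L n HL); pose proof (Hpos W n HW).
    apply rect_int_affine_error with (p := (p, q)) (al := h (p, q)) (be := dh); try lra.
    - eapply cont_rect_sub; eauto.
    - intros u v Hu Hv.
      assert (Hd : Cmod ((u, v) - (p, q)) <= D).
      { eapply Rle_trans; [apply (Cmod_le_Rabs (u + - p) (v + - q))|].
        rewrite <- HD; apply Rplus_le_compat; apply Rabs_le; lra. }
      eapply Rle_trans; [apply Herr; lra|].
      apply Rmult_le_compat_l; lra. }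
  replace ((x + L / 2 ^ n - x) + (y + W / 2 ^ n - y)) with D in Hest by (rewrite <- HD; ring).
  assert (F : 0 < 4 ^ n) by (apply pow_lt; lra).
  assert (Q : 4 ^ n * (D * D) = S2 * S2).
  { unfold D; replace 4 with (2 * 2) by ring; rewrite Rpow_mult_distr; field; apply Rgt_not_eq, Hpow. }
  assert (K <= 2 * eps * (S2 * S2)).
  { rewrite <- Q; eapply Rle_trans; [exact HP|].
    eapply Rle_trans; [apply Rmult_le_compat_l; [lra|exact Hest]|]; right; ring. }
  assert (eps * (4 * (S2 * S2 + 1)) = K) by (unfold eps; field; nra).
  nra.
Qed.

(** * Circle means and the mean value property *)

Definition Cexp (z : C) : C := (exp (fst z) * cos (snd z), exp (fst z) * sin (snd z)).

Lemma holo_Cexp (z : C) : holo Cexp z.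
Proof.
assert (Hcomp : forall (p : C -> R) (g : R -> R) (d : R),
  is_linear (K := R_AbsRing) (U := C_R_NormedModule) (V := R_NormedModule) p ->
  is_derive g (p z) d -> diff_at_C (fun u => g (p u)) z (fun h => p h * d)).
{ intros p g d Hp Hg.
  apply (filterdiff_comp' (K := R_AbsRing) (U := C_R_NormedModule) (V := R_NormedModule)
    (W := R_NormedModule) p g z p (fun h => h * d)); [|exact Hg].
  apply (filterdiff_linear (K := R_AbsRing) (U := C_R_NormedModule) (V := R_NormedModule)), Hp. }
assert (Hfst := Hcomp (fun u : C => fst u) exp _
  (is_linear_fst (K := R_AbsRing) (U := R_NormedModule) (V := R_NormedModule)) (is_derive_exp _)).
assert (Hcos := Hcomp (fun u : C => snd u) cos _
  (is_linear_snd (K := R_AbsRing) (U := R_NormedModule) (V := R_NormedModule)) (is_derive_cos _)).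
assert (Hsin := Hcomp (fun u : C => snd u) sin _
  (is_linear_snd (K := R_AbsRing) (U := R_NormedModule) (V := R_NormedModule)) (is_derive_sin _)).
apply (holo_of_cauchy_riemann _ _ _ _ _
  (filterdiff_mult_fct (K := R_AbsRing) (U := C_R_NormedModule) _ _ _ _ _ Rmult_comm Hfst Hcos)
  (filterdiff_mult_fct (K := R_AbsRing) (U := C_R_NormedModule) _ _ _ _ _ Rmult_comm Hfst Hsin)).
- change (1 * exp (fst z) * cos (snd z) + exp (fst z) * (0 * - sin (snd z)) =
    0 * exp (fst z) * sin (snd z) + exp (fst z) * (1 * cos (snd z))); ring.
- change (0 * exp (fst z) * cos (snd z) + exp (fst z) * (1 * - sin (snd z)) =
    - (1 * exp (fst z) * sin (snd z) + exp (fst z) * (0 * cos (snd z)))); ring.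
Qed.

(** The values of [Cexp] on vertical lines, with the exponential of the abscissa
    replaced by [r], so that the centre [r = 0] is included. *)
Definition polar (r t : R) : C := (r * cos t, r * sin t).

Lemma Cmod_polar (r t : R) : Cmod (polar r t) = Rabs r.
Proof.
unfold Cmod, polar; simpl fst; simpl snd.
replace ((r * cos t) ^ 2 + (r * sin t) ^ 2) with (r ^ 2 * (Rsqr (sin t) + Rsqr (cos t)))
  by (unfold Rsqr; ring).
rewrite sin2_cos2, Rmult_1_r, <- pow2_abs; apply sqrt_pow2, Rabs_pos.
Qed.

Lemma continuous_polar (p : R * R) : continuous (fun q : R * R => polar (fst q) (snd q)) p.
Proof.
assert (Hc : continuous (fun q : R * R => fst q * cos (snd q)) p).
{ apply (continuous_mult (K := R_AbsRing) (fun q : R * R => fst q) (fun q => cos (snd q))).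
  - apply continuous_fst.
  - apply (continuous_comp (fun q : R * R => snd q) cos); [apply continuous_snd|apply continuous_cos]. }
assert (Hs : continuous (fun q : R * R => fst q * sin (snd q)) p).
{ apply (continuous_mult (K := R_AbsRing) (fun q : R * R => fst q) (fun q => sin (snd q))).
  - apply continuous_fst.
  - apply (continuous_comp (fun q : R * R => snd q) sin); [apply continuous_snd|apply continuous_sin]. }
apply (continuous_comp_2 _ _ (fun a b => (a, b) : C) p Hc Hs).
apply (continuous_ext (fun z => z)); [intros []; reflexivity|apply continuous_id].
Qed.

(** The integral of [g] over the circle in the angle, not divided by [2 * PI]: the mean
    value property reads [circ g r = 2 * PI * g 0]. *)
Definition circ (g : C -> C) (r : R) : C := CInt (fun t => g (polar r t)) 0 (2 * PI).

Lemma two_PI_pos : 0 < 2 * PI.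
Proof. pose proof PI_RGT_0; lra. Qed.

Lemma Ccont_on_circle (g : C -> C) (r a b : R) :
  (forall z, Cmod z = Rabs r -> continuous g z) -> Ccont_on (fun t => g (polar r t)) a b.
Proof.
intros H t _; apply (continuous_comp (fun t => polar r t) g); [|apply H, Cmod_polar].
apply (continuous_comp (fun t : R => (r, t)) (fun q : R * R => polar (fst q) (snd q)));
  [|apply continuous_polar].
apply (continuous_comp_2 (fun _ => r) (fun t : R => t) (fun a b => (a, b)));
  [apply continuous_const|apply continuous_id|].
apply (continuous_ext (fun z => z)); [intros []; reflexivity|apply continuous_id].
Qed.

(** In logarithmic coordinates the annulus is a rectangle of height [2 * PI], on which
    [g (Cexp z)] is holomorphic and takes the same values on both horizontal sides.  So these
    cancel in Goursat's theorem, and what remains says that the vertical sides agree. *)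
Lemma circ_annulus_closed (g : C -> C) (r1 r2 : R) :
  0 < r1 <= r2 -> (forall z, r1 <= Cmod z <= r2 -> holo g z) -> circ g r1 = circ g r2.
Proof.
intros Hr Hg.
assert (Hl : ln r1 <= ln r2) by (apply ln_le; lra).
pose proof two_PI_pos as Hpi.
assert (exp_mono : forall u v, u <= v -> exp u <= exp v).
{ intros u v [Huv| ->]; [left; apply exp_increasing; auto|right; auto]. }
assert (Hh : forall x y, ln r1 <= x <= ln r2 -> 0 <= y <= 2 * PI -> holo (fun u => g (Cexp u)) (x, y)).
{ intros x y Hx Hy; apply (holo_comp g Cexp); [|apply holo_Cexp].
  apply Hg; change (Cexp (x, y)) with (polar (exp x) y); rewrite Cmod_polar, Rabs_pos_eq
    by (left; apply exp_pos).
  rewrite <- (exp_ln r1), <- (exp_ln r2) by lra; split; apply exp_mono; lra. }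
pose proof (goursat _ _ _ 0 (2 * PI) Hl (Rlt_le _ _ Hpi) Hh) as G.
unfold rect_int in G.
rewrite (CInt_ext _ (fun _ => 0%C) (ln r1)) in G; auto.
2: { intros x _; unfold Cexp; simpl fst; simpl snd.
     rewrite cos_2PI, sin_2PI, cos_0, sin_0; ring. }
rewrite CInt_const in G.
assert (C1 : forall r, r1 <= r <= r2 -> Ccont_on (fun y => g (polar r y)) 0 (2 * PI)).
{ intros r Hr'; apply Ccont_on_circle; intros z Hz; apply holo_continuous, Hg.
  rewrite Hz, Rabs_pos_eq; lra. }
rewrite (CInt_ext _ (fun y => g (polar r2 y) - g (polar r1 y))%C) in G; [|lra|].
2: { intros y _; unfold Cexp; simpl fst; simpl snd; rewrite !exp_ln by lra; reflexivity. }
rewrite CInt_minus in G; [|lra|apply C1; lra|apply C1; lra].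
fold (circ g r1) (circ g r2) in G.
(* multiply the vanishing rectangle integral by [- Ci] to isolate the vertical sides *)
assert (E : (circ g r2 - circ g r1 = (- Ci) * (RtoC (ln r2 - ln r1) * 0 + Ci * (circ g r2 - circ g r1)))%C).
{ unfold Ci; generalize (circ g r2) (circ g r1); intros [] [].
  apply injective_projections; simpl; ring. }
rewrite G in E.
replace (circ g r1) with (circ g r2 - (circ g r2 - circ g r1))%C by ring.
rewrite E; ring.
Qed.

(** Uniform continuity near the compact circle of radius [r0]. *)
Lemma circ_continuous (g : C -> C) (r0 eps : R) :
  0 <= r0 -> 0 < eps -> (forall z, Cmod z = r0 -> continuous g z) ->
  exists del, 0 < del /\ forall r, 0 <= r -> Rabs (r - r0) < del ->
    (forall z, Cmod z = r -> continuous g z) -> Cmod (circ g r - circ g r0) <= 2 * PI * eps.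
Proof.
intros Hr0 Heps Hg; pose proof two_PI_pos as Hpi.
assert (Hcg : forall t, continuous (fun q : R * R => g (polar (fst q) (snd q))) (r0, t)).
{ intros t; apply (continuous_comp (fun q : R * R => polar (fst q) (snd q)) g); [apply continuous_polar|].
  apply Hg; rewrite Cmod_polar; apply Rabs_pos_eq; auto. }
assert (H2 : 0 < eps / 2) by lra.
destruct (uniform_continuity_2d_1d' (fun r t => fst (g (polar r t))) 0 (2 * PI) r0) with (eps := mkposreal _ H2)
  as [d1 Hd1].
{ intros t _; apply continuity_2d_pt_filterlim.
  apply (continuous_comp (fun q : R * R => g (polar (fst q) (snd q))) (fun z : C => fst z)); auto.
  apply (continuous_fst (U := R_UniformSpace) (V := R_UniformSpace)). }
destruct (uniform_continuity_2d_1d' (fun r t => snd (g (polar r t))) 0 (2 * PI) r0) with (eps := mkposreal _ H2)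
  as [d2 Hd2].
{ intros t _; apply continuity_2d_pt_filterlim.
  apply (continuous_comp (fun q : R * R => g (polar (fst q) (snd q))) (fun z : C => snd z)); auto.
  apply (continuous_snd (U := R_UniformSpace) (V := R_UniformSpace)). }
exists (Rmin d1 d2); split; [apply Rmin_pos; apply cond_pos|].
intros r Hr Hrr Hgr.
assert (C0 : Ccont_on (fun t => g (polar r0 t)) 0 (2 * PI))
  by (apply Ccont_on_circle; rewrite Rabs_pos_eq; auto).
assert (C1 : Ccont_on (fun t => g (polar r t)) 0 (2 * PI))
  by (apply Ccont_on_circle; rewrite Rabs_pos_eq; auto).
unfold circ; rewrite <- CInt_minus; auto; [|lra].
replace (2 * PI * eps) with ((2 * PI - 0) * eps) by ring.
apply CInt_Cmod_le; [lra|apply Ccont_on_minus; auto|].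
intros t Ht.
assert (Hm : Rabs (r - r0) < d1 /\ Rabs (r - r0) < d2).
{ pose proof (Rmin_l d1 d2); pose proof (Rmin_r d1 d2); lra. }
destruct Hm as [Hm1 Hm2]; apply Rabs_def2 in Hm1; apply Rabs_def2 in Hm2.
specialize (Hd1 t r0 t r Ht ltac:(pose proof (cond_pos d1); lra) Ht ltac:(lra)
  ltac:(rewrite Rminus_eq_0, Rabs_R0; apply cond_pos)).
specialize (Hd2 t r0 t r Ht ltac:(pose proof (cond_pos d2); lra) Ht ltac:(lra)
  ltac:(rewrite Rminus_eq_0, Rabs_R0; apply cond_pos)).
simpl in Hd1, Hd2.
eapply Rle_trans; [apply (Cmod_le_Rabs (fst (g (polar r t)) - fst (g (polar r0 t))) (snd (g (polar r t)) - snd (g (polar r0 t))))|].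
lra.
Qed.

(** Continuity of the circle integrals in the radius removes the differentiability on the two
    bounding circles; this is what makes an exceptional point, and the radius 0, harmless. *)
Lemma circ_annulus (g : C -> C) (r1 r2 : R) :
  0 <= r1 < r2 -> (forall z, r1 <= Cmod z <= r2 -> continuous g z) ->
  (forall z, r1 < Cmod z < r2 -> holo g z) -> circ g r1 = circ g r2.
Proof.
intros Hr Hc Hg; pose proof two_PI_pos as Hpi.
assert (E : (circ g r1 - circ g r2)%C = 0%C).
{ apply Cmod_eq_0; apply Rle_antisym; [|apply Cmod_ge_0].
  apply le_epsilon; intros e He; rewrite Rplus_0_l.
  set (eps := e / (4 * PI)).
  assert (Heps : 0 < eps) by (apply Rdiv_lt_0_compat; lra).
  destruct (circ_continuous g r1 eps) as [d1 [Hd1 H1]]; try lra; [intros; apply Hc; lra|].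
  destruct (circ_continuous g r2 eps) as [d2 [Hd2 H2]]; try lra; [intros; apply Hc; lra|].
  set (d := Rmin (Rmin d1 d2) (r2 - r1)).
  assert (Hd : 0 < d /\ d <= d1 /\ d <= d2 /\ d <= r2 - r1).
  { unfold d; split; [repeat apply Rmin_pos; lra|].
    pose proof (Rmin_l (Rmin d1 d2) (r2 - r1)); pose proof (Rmin_r (Rmin d1 d2) (r2 - r1)).
    pose proof (Rmin_l d1 d2); pose proof (Rmin_r d1 d2); lra. }
  assert (E : circ g (r1 + d / 2) = circ g (r2 - d / 3)).
  { apply circ_annulus_closed; [lra|]; intros; apply Hg; lra. }
  specialize (H1 (r1 + d / 2) ltac:(lra) ltac:(apply Rabs_def1; lra) ltac:(intros; apply Hc; lra)).
  specialize (H2 (r2 - d / 3) ltac:(lra) ltac:(apply Rabs_def1; lra) ltac:(intros; apply Hc; lra)).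
  rewrite <- E in H2.
  replace (circ g r1 - circ g r2)%C with
    (- (circ g (r1 + d / 2) - circ g r1) + (circ g (r1 + d / 2) - circ g r2))%C by ring.
  eapply Rle_trans; [apply Cmod_triangle|]; rewrite Cmod_opp.
  assert (4 * PI * eps = e) by (unfold eps; field; lra); lra. }
replace (circ g r1) with (circ g r1 - circ g r2 + circ g r2)%C by ring; rewrite E; ring.
Qed.

Lemma circ_0 (g : C -> C) : circ g 0 = (RtoC (2 * PI) * g 0)%C.
Proof.
pose proof two_PI_pos.
unfold circ; rewrite (CInt_ext _ (fun _ => g 0)); [|lra|].
- rewrite CInt_const, Rminus_0_r; reflexivity.
- intros t _; unfold polar; f_equal; rewrite !Rmult_0_l; reflexivity.
Qed.

(** The exceptional point [w] lies on a single circle around the origin, so the circle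
    integrals are constant on either side of that circle, down to radius 0. *)
Lemma mean_value (g : C -> C) (r : R) (w : C) :
  0 < r -> (forall z, Cmod z <= r -> continuous g z) ->
  (forall z, Cmod z <= r -> z <> w -> holo g z) -> circ g r = (RtoC (2 * PI) * g 0)%C.
Proof.
intros Hr Hc Hg; rewrite <- circ_0.
pose proof (Cmod_ge_0 w).
destruct (Rlt_dec 0 (Cmod w)) as [H0|H0]; [destruct (Rlt_dec (Cmod w) r) as [H1|H1]|].
- rewrite <- (circ_annulus g (Cmod w) r), <- (circ_annulus g 0 (Cmod w)); auto; try lra;
    intros z Hz; try (apply Hc; lra); apply Hg; try lra; intros ->; lra.
- symmetry; apply circ_annulus; try lra; intros z Hz; try (apply Hc; lra).
  apply Hg; try lra; intros ->; lra.
- symmetry; apply circ_annulus; try lra; intros z Hz; try (apply Hc; lra).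
  apply Hg; try lra; intros ->; lra.
Qed.

(** * Cauchy's formula, isolated zeros and the identity theorem *)

Lemma circ_ext (f g : C -> C) (r : R) :
  0 <= r -> (forall z, Cmod z = r -> f z = g z) -> circ f r = circ g r.
Proof.
intros Hr H; pose proof two_PI_pos; unfold circ; apply CInt_ext; [lra|].
intros t _; apply H; rewrite Cmod_polar; apply Rabs_pos_eq; auto.
Qed.

Lemma circ_minus (f g : C -> C) (r : R) :
  0 <= r -> (forall z, Cmod z = r -> continuous f z) -> (forall z, Cmod z = r -> continuous g z) ->
  circ (fun z => f z - g z)%C r = (circ f r - circ g r)%C.
Proof.
intros Hr Hf Hg; pose proof two_PI_pos; unfold circ; apply CInt_minus; [lra| |];
  apply Ccont_on_circle; rewrite Rabs_pos_eq; auto.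
Qed.

Lemma circ_plus (f g : C -> C) (r : R) :
  0 <= r -> (forall z, Cmod z = r -> continuous f z) -> (forall z, Cmod z = r -> continuous g z) ->
  circ (fun z => f z + g z)%C r = (circ f r + circ g r)%C.
Proof.
intros Hr Hf Hg; pose proof two_PI_pos; unfold circ; apply CInt_plus; [lra| |];
  apply Ccont_on_circle; rewrite Rabs_pos_eq; auto.
Qed.

Lemma circ_scal (c : C) (g : C -> C) (r : R) :
  0 <= r -> (forall z, Cmod z = r -> continuous g z) ->
  circ (fun z => c * g z)%C r = (c * circ g r)%C.
Proof.
intros Hr Hg; pose proof two_PI_pos; unfold circ; apply CInt_scal; [lra|].
apply Ccont_on_circle; rewrite Rabs_pos_eq; auto.
Qed.

Lemma circ_le (g : C -> C) (r M : R) :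
  0 <= r -> (forall z, Cmod z = r -> continuous g z) -> (forall z, Cmod z = r -> Cmod (g z) <= M) ->
  Cmod (circ g r) <= 2 * PI * M.
Proof.
intros Hr Hg HM; pose proof two_PI_pos.
replace (2 * PI * M) with ((2 * PI - 0) * M) by ring.
unfold circ; apply CInt_Cmod_le; [lra| |].
- apply Ccont_on_circle; rewrite Rabs_pos_eq; auto.
- intros t _; apply HM; rewrite Cmod_polar; apply Rabs_pos_eq; auto.
Qed.

Lemma Cmod_minus_ge (z w : C) : Cmod z - Cmod w <= Cmod (z - w).
Proof.
pose proof (Cmod_triangle (z - w) w) as T.
replace (z - w + w)%C with z in T by ring; lra.
Qed.

Lemma Cminus_neq_0 (z w : C) : z <> w -> (z - w)%C <> 0%C.
Proof. intros H E; apply H; replace z with (z - w + w)%C by ring; rewrite E; ring. Qed.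

Lemma neq_of_Cmod_lt (z w : C) : Cmod w < Cmod z -> z <> w.
Proof. intros H ->; lra. Qed.

Lemma holo_cauchy_kernel (w z : C) : z <> w -> holo (fun z => z / (z - w))%C z.
Proof.
intros H; apply holo_div; [apply holo_id| |apply Cminus_neq_0; auto].
apply holo_minus; [apply holo_id|apply holo_const].
Qed.

(** The integral does not depend on the radius, and the integrand tends to 1 as the radius
    grows. *)
Lemma circ_cauchy_kernel (w : C) (r : R) :
  Cmod w < r -> circ (fun z => z / (z - w))%C r = RtoC (2 * PI).
Proof.
intros Hw; pose proof (Cmod_ge_0 w) as Hw0; pose proof two_PI_pos as Hpi.
assert (Hc : forall r', r <= r' -> forall z, Cmod z = r' -> continuous (fun z => z / (z - w))%C z).
{ intros r' Hr' z Hz; apply holo_continuous, holo_cauchy_kernel, neq_of_Cmod_lt; lra. }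
assert (E : (circ (fun z => z / (z - w)) r - RtoC (2 * PI))%C = 0%C).
2: { replace (circ _ r) with (circ (fun z => z / (z - w)) r - RtoC (2 * PI) + RtoC (2 * PI))%C by ring.
     rewrite E; ring. }
apply Cmod_eq_0, Rle_antisym; [|apply Cmod_ge_0].
apply le_epsilon; intros e He; rewrite Rplus_0_l.
(* a radius at which the bound [2 * PI * Cmod w / (r' - Cmod w)] is at most [e] *)
set (r' := r + 2 * PI * Cmod w / e).
assert (Hq : 0 <= 2 * PI * Cmod w / e) by (apply Rdiv_le_0_compat; nra).
rewrite (circ_annulus_closed _ r r').
2: { unfold r'; lra. }
2: { intros z Hz; apply holo_cauchy_kernel, neq_of_Cmod_lt; lra. }
assert (Hrr : r <= r') by (unfold r'; lra).
replace (RtoC (2 * PI)) with (circ (fun _ => 1%C) r').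
2: { unfold circ; rewrite CInt_const, Rminus_0_r; ring. }
rewrite <- circ_minus; [|lra|apply Hc; auto|intros; apply continuous_const].
assert (Hk : forall z, Cmod z = r' -> Cmod (z / (z - w) - 1) <= Cmod w / (r' - Cmod w)).
{ intros z Hz; assert (Hzw : z <> w) by (apply neq_of_Cmod_lt; lra).
  apply Cminus_neq_0 in Hzw.
  replace (z / (z - w) - 1)%C with (w / (z - w))%C by (field; auto).
  rewrite Cmod_div by auto.
  apply Rmult_le_compat_l; auto; apply Rinv_le_contravar; [lra|].
  rewrite <- Hz; apply Cmod_minus_ge. }
eapply Rle_trans; [apply circ_le with (M := Cmod w / (r' - Cmod w)); auto; [lra|]|].
- intros z Hz; apply (continuous_minus (V := C_R_NormedModule)); [eapply Hc; eauto|apply continuous_const].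
- assert (Hd : 0 < r' - Cmod w) by lra.
  apply Rmult_le_reg_r with (r' - Cmod w); auto.
  replace (2 * PI * (Cmod w / (r' - Cmod w)) * (r' - Cmod w)) with (2 * PI * Cmod w) by (field; lra).
  assert (E2 : e * r' = e * r + 2 * PI * Cmod w) by (unfold r'; field; lra).
  nra.
Qed.

Lemma locally_neq (z w : C) : z <> w -> locally z (fun u => u <> w).
Proof.
intros H; apply locally_Cmod; exists (Cmod (z - w)).
split; [apply Cmod_gt_0, Cminus_neq_0; auto|].
intros u Hu ->; replace (w - z)%C with (- (z - w))%C in Hu by ring; rewrite Cmod_opp in Hu; lra.
Qed.

(** Mean value property for [z] times the difference quotient [q] of [g] at [w], a function
    that vanishes at 0, is continuous, and is holomorphic except perhaps at [w].  It is written
    as [(g z - g w) + w * q z], so that its continuity at [w] is visibly that of [q]. *)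
Lemma cauchy_formula (g : C -> C) (r : R) (w : C) :
  (forall z, Cmod z <= r -> holo g z) -> Cmod w < r ->
  circ (fun z => g z * (z / (z - w)))%C r = (RtoC (2 * PI) * g w)%C.
Proof.
intros Hg Hw; pose proof (Cmod_ge_0 w) as Hw0.
destruct (Hg w) as [dw Hdw]; [lra|].
set (q := fun z => if excluded_middle_informative (z = w) then dw else ((g z - g w) / (z - w))%C).
assert (Hqw : q w = dw).
{ unfold q; destruct (excluded_middle_informative (w = w)); congruence. }
assert (Hqz : forall z, z <> w -> q z = ((g z - g w) / (z - w))%C).
{ intros z Hz; unfold q; destruct (excluded_middle_informative (z = w)); congruence. }
assert (Hqh : forall z, Cmod z <= r -> z <> w -> holo q z).
{ intros z Hz Hzw; apply (holo_ext_loc (fun z => (g z - g w) / (z - w))%C).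
  - generalize (locally_neq z w Hzw); apply filter_imp; intros u Hu; symmetry; auto.
  - apply holo_div; [| |apply Cminus_neq_0; auto]; apply holo_minus; auto using holo_id, holo_const. }
assert (Hqc : forall z, Cmod z <= r -> continuous q z).
{ intros z Hz; destruct (excluded_middle_informative (z = w)) as [->|Hzw]; [|apply holo_continuous; auto].
  apply continuous_Cmod; intros eps Heps.
  destruct (proj1 (is_Cderive_Cmod _ _ _) Hdw (eps / 2)) as [d [Hd He]]; [lra|].
  exists d; split; auto; intros u Hu; rewrite Hqw.
  destruct (excluded_middle_informative (u = w)) as [->|Huw].
  - rewrite Hqw; replace (dw - dw)%C with (RtoC 0) by ring; rewrite Cmod_0; auto.
  - rewrite Hqz by auto; specialize (He u Hu); apply Cminus_neq_0 in Huw.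
    replace ((g u - g w) / (u - w) - dw)%C with ((g u - g w - dw * (u - w)) / (u - w))%C by (field; auto).
    rewrite Cmod_div by auto.
    assert (0 < Cmod (u - w)) by (apply Cmod_gt_0; auto).
    apply Rle_lt_trans with (eps / 2); [|lra].
    apply Rmult_le_reg_r with (Cmod (u - w)); auto.
    unfold Rdiv at 1; rewrite Rmult_assoc, Rinv_l by lra; lra. }
assert (Hm : circ (fun z => (g z - g w) + w * q z)%C r = 0%C).
{ rewrite (mean_value _ r w); try lra.
  - destruct (excluded_middle_informative (RtoC 0 = w)) as [<-|H0w]; [ring|].
    rewrite Hqz by auto; field; auto.
  - intros z Hz; apply (continuous_plus (V := C_R_NormedModule)).
    + apply holo_continuous, holo_minus; auto using holo_const.
    + apply (continuous_comp q (fun v => w * v)%C); auto.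
      apply (linear_cont (K := R_AbsRing) (U := C_R_NormedModule) (V := C_R_NormedModule)), is_linear_Cmult.
  - intros z Hz Hzw; apply holo_plus; [apply holo_minus|apply holo_scal]; auto using holo_const. }
rewrite (circ_ext _ (fun z => g z * (z / (z - w)) - g w * (z / (z - w)))%C) in Hm; [|lra|].
2: { intros z Hz; assert (Hzw : z <> w) by (apply neq_of_Cmod_lt; lra).
     rewrite Hqz by auto; apply Cminus_neq_0 in Hzw; field; auto. }
assert (Hk : forall z, Cmod z = r -> holo (fun z => z / (z - w))%C z).
{ intros z Hz; apply holo_cauchy_kernel, neq_of_Cmod_lt; lra. }
rewrite circ_minus, circ_scal, circ_cauchy_kernel in Hm; auto; try lra.
- replace (circ (fun z => g z * (z / (z - w))) r)%C with
    (circ (fun z => g z * (z / (z - w))) r - g w * RtoC (2 * PI) + g w * RtoC (2 * PI))%C by ring.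
  rewrite Hm; ring.
- intros; apply holo_continuous; auto.
- intros; apply holo_continuous, holo_mult; auto; apply Hg; lra.
- intros; apply holo_continuous, holo_scal; auto.
Qed.

(** The first bound is attained, so it is positive as soon as [g] has no zero on the circle. *)
Lemma bounded_on_circle (g : C -> C) (r : R) :
  0 <= r -> (forall z, Cmod z = r -> continuous g z) ->
  exists m M, (forall z, Cmod z = r -> m <= Cmod (g z) <= M) /\
    (exists z, Cmod z = r /\ Cmod (g z) = m).
Proof.
intros Hr Hg; pose proof two_PI_pos as Hpi.
assert (Hc : forall t, 0 <= t <= 2 * PI -> continuity_pt (fun t => Cmod (g (polar r t))) t).
{ intros t Ht.
  pose proof (Ccont_on_circle g r 0 (2 * PI) ltac:(rewrite Rabs_pos_eq; auto)) as H.
  apply continuity_pt_filterlim.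
  apply (filterlim_ext (fun t => norm (V := C_R_NormedModule) (g (polar r t)))).
  - intros s; symmetry; apply Cmod_norm.
  - apply (filterlim_comp _ _ _ (fun t => g (polar r t)) (norm (V := C_R_NormedModule)) _ (locally (g (polar r t)))).
    + apply H; auto.
    + rewrite Cmod_norm; apply (filterlim_norm (V := C_R_NormedModule)). }
assert (Hpol : forall z, Cmod z = r -> exists t, 0 <= t <= 2 * PI /\ z = polar r t).
{ intros [x y] Hz; unfold polar.
  destruct (Rle_lt_or_eq_dec 0 r Hr) as [Hr0|<-].
  2: { apply Cmod_eq_0 in Hz; exists 0; split; [lra|]; rewrite Hz; unfold RtoC; f_equal; ring. }
  assert (Hxy : x * x + y * y = r * r).
  { rewrite <- Hz; unfold Cmod; simpl fst; simpl snd; rewrite sqrt_sqrt; nra. }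
  assert (Hx : -1 <= x / r <= 1).
  { split; apply Rmult_le_reg_r with r; auto; unfold Rdiv; rewrite Rmult_assoc, Rinv_l by lra; nra. }
  assert (Hs : r * sqrt (1 - (x / r)²) = Rabs y).
  { rewrite <- (sqrt_Rsqr_abs y), <- (sqrt_Rsqr r) at 1 by lra.
    rewrite <- sqrt_mult_alt by apply Rle_0_sqr; f_equal; unfold Rsqr.
    field_simplify; [nra|lra]. }
  assert (Hrx : r * (x / r) = x) by (field; lra).
  pose proof (acos_bound (x / r)).
  destruct (Rle_dec 0 y) as [Hy|Hy].
  - exists (acos (x / r)); split; [lra|].
    rewrite cos_acos, sin_acos, Hs, Hrx, Rabs_pos_eq by auto; reflexivity.
  - exists (2 * PI - acos (x / r)); split; [lra|].
    rewrite cos_minus, sin_minus, cos_2PI, sin_2PI, cos_acos, sin_acos by auto.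
    rewrite Rabs_left in Hs by lra; f_equal; lra. }
destruct (continuity_ab_maj _ 0 (2 * PI) ltac:(lra) Hc) as [tM [HM _]].
destruct (continuity_ab_min _ 0 (2 * PI) ltac:(lra) Hc) as [tm [Hm _]].
exists (Cmod (g (polar r tm))), (Cmod (g (polar r tM))); split.
- intros z Hz; destruct (Hpol z Hz) as [t [Ht ->]]; auto.
- exists (polar r tm); split; auto; rewrite Cmod_polar; apply Rabs_pos_eq; auto.
Qed.

Lemma holo_pow (n : nat) (z : C) : holo (fun u => (u ^ n)%C) z.
Proof.
induction n as [|n IH]; [exact (holo_const 1%C z)|].
apply (holo_mult (fun u => u) (fun u => (u ^ n)%C)); auto using holo_id.
Qed.

Definition taylor_coef (g : C -> C) (r : R) (n : nat) : C := circ (fun z => g z / z ^ n)%C r.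

(** Expanding [z / (z - w)] in Cauchy's formula as a finite geometric sum leaves
    [w ^ n * taylor_rest g r n w] as the remainder of order [n] (up to the factor [2 * PI]). *)
Definition taylor_rest (g : C -> C) (r : R) (n : nat) (w : C) : C :=
  circ (fun z => g z / z ^ n * (z / (z - w)))%C r.

Section Taylor.
Variables (g : C -> C) (r : R).
Hypothesis (Hr : 0 < r) (Hg : forall z, Cmod z <= r -> holo g z).

Lemma circle_neq_0 z : Cmod z = r -> z <> 0%C.
Proof. intros H E; rewrite E, Cmod_0 in H; lra. Qed.

Lemma taylor_coef_holo n z : Cmod z = r -> holo (fun z => g z / z ^ n)%C z.
Proof.
intros Hz; apply holo_div; [apply Hg; lra|apply holo_pow|apply Cpow_nz, circle_neq_0; auto].
Qed.

Lemma taylor_rest_holo n w z : Cmod w < r -> Cmod z = r ->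
  holo (fun z => g z / z ^ n * (z / (z - w)))%C z.
Proof.
intros Hw Hz; apply holo_mult; [apply taylor_coef_holo; auto|].
apply holo_cauchy_kernel, neq_of_Cmod_lt; lra.
Qed.

Lemma taylor_rest_0 w : Cmod w < r -> taylor_rest g r 0 w = (RtoC (2 * PI) * g w)%C.
Proof.
intros Hw; rewrite <- (cauchy_formula g r) by auto.
apply circ_ext; [lra|]; intros z Hz.
assert (Hzw : z <> w) by (apply neq_of_Cmod_lt; lra); apply Cminus_neq_0 in Hzw.
simpl; field; auto.
Qed.

Lemma taylor_rest_S n w : Cmod w < r ->
  taylor_rest g r n w = (taylor_coef g r n + w * taylor_rest g r (S n) w)%C.
Proof.
intros Hw; unfold taylor_rest, taylor_coef.
rewrite <- circ_scal, <- circ_plus; try lra.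
- apply circ_ext; [lra|]; intros z Hz.
  assert (Hzw : z <> w) by (apply neq_of_Cmod_lt; lra); apply Cminus_neq_0 in Hzw.
  assert (Hz0 : z <> 0%C) by (apply circle_neq_0; auto).
  assert ((z ^ n)%C <> 0%C) by (apply Cpow_nz; auto).
  rewrite Cpow_S; field; auto.
- intros; apply holo_continuous, taylor_coef_holo; auto.
- intros; apply holo_continuous, holo_scal, (taylor_rest_holo (S n)); auto.
- intros; apply holo_continuous, (taylor_rest_holo (S n)); auto.
Qed.

Lemma taylor_rest_first n : (forall j, (j < n)%nat -> taylor_coef g r j = 0%C) ->
  forall w, Cmod w < r -> (RtoC (2 * PI) * g w)%C = (w ^ n * taylor_rest g r n w)%C.
Proof.
intros Hn w Hw; rewrite <- taylor_rest_0 by auto.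
induction n as [|n IH]; [simpl; ring|].
rewrite IH by auto; rewrite (taylor_rest_S n), (Hn n), Cpow_S by auto; ring.
Qed.

Lemma taylor_rest_le M : (forall z, Cmod z = r -> Cmod (g z) <= M) ->
  forall n w, Cmod w < r -> Cmod (taylor_rest g r n w) <= 2 * PI * (M / r ^ n * (r / (r - Cmod w))).
Proof.
intros HM n w Hw; apply circ_le; [lra| |].
- intros; apply holo_continuous, taylor_rest_holo; auto.
- intros z Hz.
  assert (Hzw : z <> w) by (apply neq_of_Cmod_lt; lra); apply Cminus_neq_0 in Hzw.
  rewrite Cmod_mult, !Cmod_div, Cmod_pow, Hz; auto.
  2: { apply Cpow_nz, circle_neq_0; auto. }
  assert (Hp : 0 < / r ^ n) by (apply Rinv_0_lt_compat, pow_lt; auto).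
  pose proof (Cmod_ge_0 (g z)); pose proof (HM z Hz).
  pose proof (Cmod_minus_ge z w) as Hge; rewrite Hz in Hge.
  assert (Hi : 0 < / Cmod (z - w) <= / (r - Cmod w)).
  { split; [apply Rinv_0_lt_compat|apply Rinv_le_contravar]; lra. }
  apply Rmult_le_compat; unfold Rdiv; nra.
Qed.
End Taylor.

(** If all Taylor coefficients vanish, [g w] is its own remainder of every order, which
    tends to 0 like [(Cmod w / r) ^ n].  Otherwise [g w] is, up to a constant
    factor, [w ^ n] times the sum of the first nonzero coefficient and a function that is
    bounded by a multiple of [Cmod w]. *)
Lemma taylor_dichotomy (g : C -> C) (r : R) :
  0 < r -> (forall z, Cmod z <= r -> holo g z) ->
  (forall z, Cmod z < r -> g z = 0%C) \/
  (exists eta, 0 < eta /\ forall z, 0 < Cmod z < eta -> g z <> 0%C).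
Proof.
intros Hr Hg; pose proof two_PI_pos as Hpi.
destruct (bounded_on_circle g r) as [m [M [HM _]]]; [lra|intros; apply holo_continuous, Hg; lra|].
assert (HM' : forall z, Cmod z = r -> Cmod (g z) <= M) by (intros; apply HM; auto); clear m HM.
assert (HM0 : 0 <= M).
{ eapply Rle_trans; [apply Cmod_ge_0|]; apply (HM' (polar r 0)); rewrite Cmod_polar, Rabs_pos_eq; lra. }
assert (Hnz : forall z, (RtoC (2 * PI) * g z)%C = 0%C -> g z = 0%C).
{ intros z E; apply Cmod_eq_0; apply (f_equal Cmod) in E.
  rewrite Cmod_mult, Cmod_R, Rabs_pos_eq, Cmod_0 in E by lra; nra. }
assert (Hfirst : (forall n, taylor_coef g r n = 0%C) \/
  exists n, taylor_coef g r n <> 0%C /\ forall j, (j < n)%nat -> taylor_coef g r j = 0%C).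
{ destruct (classic (exists n, taylor_coef g r n <> 0%C)) as [[n Hn]|H].
  - right; revert Hn; induction n as [n IH] using lt_wf_ind; intros Hn.
    destruct (classic (exists j, (j < n)%nat /\ taylor_coef g r j <> 0%C)) as [[j [Hj Hj0]]|H]; [apply (IH j); auto|].
    exists n; split; auto; intros j Hj; apply NNPP; intros Hj0; apply H; eauto.
  - left; intros n; apply NNPP; intros Hn; apply H; eauto. }
destruct Hfirst as [H0|[n [Hn Hj]]].
- left; intros w Hw; apply Hnz, Cmod_eq_0, Rle_antisym; [|apply Cmod_ge_0].
  set (q := Cmod w / r).
  assert (Hq : 0 <= q < 1).
  { pose proof (Cmod_ge_0 w); unfold q; split; [apply Rdiv_le_0_compat; auto|].
    apply Rmult_lt_reg_r with r; auto; unfold Rdiv; rewrite Rmult_assoc, Rinv_l; lra. }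
  set (K := 2 * PI * (M * (r / (r - Cmod w)))).
  assert (HK : forall n, Cmod (RtoC (2 * PI) * g w) <= K * q ^ n).
  { intros n; rewrite (taylor_rest_first g r Hr Hg n) by auto.
    rewrite Cmod_mult, Cmod_pow.
    pose proof (taylor_rest_le g r Hr Hg M HM' n w Hw) as HT.
    assert (0 < r ^ n) by (apply pow_lt; auto).
    assert (0 <= Cmod w ^ n) by (apply pow_le, Cmod_ge_0).
    eapply Rle_trans; [apply Rmult_le_compat_l; [auto|exact HT]|].
    assert (Eq : q ^ n = Cmod w ^ n / r ^ n)
      by (unfold q, Rdiv; rewrite Rpow_mult_distr, pow_inv; reflexivity).
    right; unfold K; rewrite Eq; field; lra. }
  assert (HK0 : 0 <= K).
  { unfold K; apply Rmult_le_pos; [lra|]; apply Rmult_le_pos; auto; apply Rdiv_le_0_compat; lra. }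
  apply le_epsilon; intros e He; rewrite Rplus_0_l.
  destruct (pow_lt_1_zero q ltac:(rewrite Rabs_pos_eq; lra) (e / (K + 1))) as [n Hn].
  { apply Rdiv_lt_0_compat; lra. }
  specialize (Hn n (le_n n)); rewrite Rabs_pos_eq in Hn by (apply pow_le; lra).
  eapply Rle_trans; [apply (HK n)|].
  apply Rle_trans with (K * (e / (K + 1))); [apply Rmult_le_compat_l; lra|].
  apply Rmult_le_reg_r with (K + 1); [lra|].
  replace (K * (e / (K + 1)) * (K + 1)) with (K * e) by (field; lra); nra.
- right.
  set (a := Cmod (taylor_coef g r n)).
  assert (Ha : 0 < a) by (apply Cmod_gt_0; auto).
  set (B := 2 * PI * (M / r ^ (S n) * 2)).
  assert (HB : 0 <= B).
  { assert (0 < / r ^ S n) by (apply Rinv_0_lt_compat, pow_lt; auto).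
    unfold B, Rdiv; apply Rmult_le_pos; [lra|]; apply Rmult_le_pos; [apply Rmult_le_pos|]; lra. }
  exists (Rmin (r / 2) (a / (B + 1))); split; [apply Rmin_pos; [lra|apply Rdiv_lt_0_compat; lra]|].
  intros w [Hw0 Hw] E.
  pose proof (Rmin_l (r / 2) (a / (B + 1))); pose proof (Rmin_r (r / 2) (a / (B + 1))).
  assert (Hwr : Cmod w < r) by lra.
  pose proof (taylor_rest_first g r Hr Hg n Hj w Hwr) as HT.
  rewrite E, Cmult_0_r, taylor_rest_S in HT by auto.
  assert (Hw' : w <> 0%C) by (apply Cmod_gt_0; auto).
  assert (HB2 : Cmod (taylor_rest g r (S n) w) <= B).
  { eapply Rle_trans; [apply taylor_rest_le with (M := M); auto|].
    unfold B; apply Rmult_le_compat_l; [lra|].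
    assert (0 < / r ^ S n) by (apply Rinv_0_lt_compat, pow_lt; auto).
    apply Rmult_le_compat_l; [unfold Rdiv; apply Rmult_le_pos; lra|].
    apply Rmult_le_reg_r with (r - Cmod w); [lra|].
    unfold Rdiv; rewrite Rmult_assoc, Rinv_l by lra; lra. }
  assert (HZ : (taylor_coef g r n + w * taylor_rest g r (S n) w)%C = 0%C).
  { apply NNPP; intros Z; apply (Cmult_neq_0 (w ^ n) _ (Cpow_nz w n Hw') Z).
    symmetry; exact HT. }
  assert (Ea : a = Cmod w * Cmod (taylor_rest g r (S n) w)).
  { unfold a; rewrite <- Cmod_mult, <- (Cmod_opp (w * _)); f_equal.
    replace (taylor_coef g r n) with
      (taylor_coef g r n + w * taylor_rest g r (S n) w - w * taylor_rest g r (S n) w)%C by ring.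
    rewrite HZ; ring. }
  assert (Cmod w * (B + 1) < a).
  { apply Rlt_le_trans with (a / (B + 1) * (B + 1)); [apply Rmult_lt_compat_r; lra|].
    right; field; lra. }
  nra.
Qed.

Lemma translate_holo (g : C -> C) (z0 z : C) : holo g (z0 + z)%C -> holo (fun u => g (z0 + u)%C) z.
Proof.
intros H; apply (holo_comp g (fun u => (z0 + u)%C)); auto.
apply holo_plus; [apply holo_const|apply holo_id].
Qed.

Lemma isolated_zeros (g : C -> C) (z0 : C) (del : R) :
  (forall z, Cmod (z - z0) < del -> holo g z) ->
  (forall z, Cmod (z - z0) < del -> g z = 0%C) \/
  (exists eta, 0 < eta /\ forall z, 0 < Cmod (z - z0) < eta -> g z <> 0%C).
Proof.
intros Hg.
assert (Hh : forall z, Cmod z < del -> holo (fun u => g (z0 + u)%C) z).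
{ intros z Hz; apply translate_holo, Hg; replace (z0 + z - z0)%C with z by ring; auto. }
destruct (classic (exists eta, 0 < eta /\ forall z, 0 < Cmod (z - z0) < eta -> g z <> 0%C)) as [|Hno]; auto.
left; intros z Hz; pose proof (Cmod_ge_0 (z - z0)).
destruct (taylor_dichotomy (fun u => g (z0 + u)%C) ((Cmod (z - z0) + del) / 2)) as [H0|[eta [He Hn]]].
- lra.
- intros u Hu; apply Hh; lra.
- replace z with (z0 + (z - z0))%C by ring; apply H0; lra.
- exfalso; apply Hno; exists eta; split; auto; intros u Hu.
  replace u with (z0 + (u - z0))%C by ring; auto.
Qed.

(** Otherwise [/ g] is holomorphic on the disc, and its value at the centre exceeds its
    maximum on the circle, against the mean value property. *)
Lemma minimum_modulus (g : C -> C) (z0 : C) (r m : R) :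
  0 < r -> (forall z, Cmod (z - z0) <= r -> holo g z) ->
  (forall z, Cmod (z - z0) = r -> m <= Cmod (g z)) -> Cmod (g z0) < m ->
  exists z, Cmod (z - z0) <= r /\ g z = 0%C.
Proof.
intros Hr Hg Hm H0; apply NNPP; intros Hno.
assert (Hnz : forall z, Cmod (z - z0) <= r -> g z <> 0%C) by (intros z Hz E; apply Hno; eauto).
pose proof two_PI_pos as Hpi.
assert (Htr : forall z, (z0 + z - z0)%C = z) by (intros; ring).
assert (Hh : forall z, Cmod z <= r -> holo (fun u => / g (z0 + u)%C)%C z).
{ intros z Hz; apply (translate_holo (fun u => / g u)%C); apply holo_inv; [apply Hg|apply Hnz]; rewrite Htr; auto. }
assert (Hz0 : 0 < Cmod (g z0)).
{ apply Cmod_gt_0, Hnz; replace (z0 - z0)%C with (RtoC 0) by ring; rewrite Cmod_0; lra. }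
pose proof (mean_value (fun u => / g (z0 + u)%C)%C r 0%C Hr
  (fun z Hz => holo_continuous _ _ (Hh z Hz)) (fun z Hz _ => Hh z Hz)) as E.
apply (f_equal Cmod) in E.
rewrite Cplus_0_r, Cmod_mult, Cmod_R, Rabs_pos_eq, Cmod_inv in E by (try lra; apply Cmod_gt_0; auto).
assert (L : Cmod (circ (fun u => / g (z0 + u)%C)%C r) <= 2 * PI * / m).
{ apply circ_le; [lra|intros; apply holo_continuous, Hh; lra|].
  intros z Hz; rewrite Cmod_inv by (apply Hnz; rewrite Htr; lra).
  apply Rinv_le_contravar; [lra|]; apply Hm; rewrite Htr; auto. }
rewrite E in L.
assert (/ m < / Cmod (g z0)) by (apply Rinv_lt_contravar; nra).
nra.
Qed.

(** A holomorphic function on a disc whose zeros accumulate at the centre along the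
    real axis vanishes: zeros at the centre are isolated otherwise. *)
Lemma identity_theorem_real (g : C -> C) (r eta : R) :
  0 < eta -> (forall z, Cmod z < r -> holo g z) ->
  (forall x : R, Rabs x < eta -> g (RtoC x) = 0%C) ->
  forall z, Cmod z < r -> g z = 0%C.
Proof.
intros Heta Hg H0.
destruct (isolated_zeros g 0%C r) as [Hall|[eta' [Heta' Hn]]].
- intros z Hz; apply Hg; replace (z - 0)%C with z in Hz by ring; auto.
- intros z Hz; apply Hall; replace (z - 0)%C with z by ring; auto.
- exfalso; set (x := Rmin eta eta' / 2).
  assert (Hx : 0 < x /\ x < eta /\ x < eta').
  { pose proof (Rmin_l eta eta'); pose proof (Rmin_r eta eta').
    assert (0 < Rmin eta eta') by (apply Rmin_pos; auto); unfold x; lra. }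
  apply (Hn (RtoC x)).
  + replace (x - 0)%C with (RtoC x) by ring; rewrite Cmod_R, Rabs_pos_eq; lra.
  + apply H0; rewrite Rabs_pos_eq; lra.
Qed.

(** From [z0] to the origin by finitely many discs: around every point [s * z0] the disc of
    radius [del = r - Cmod z0] is contained in the domain, so a vanishing germ spreads over that
    whole disc, and steps shorter than [del] reach the centre. *)
Lemma identity_theorem (g : C -> C) (r : R) (z0 : C) (eta : R) :
  Cmod z0 < r -> (forall z, Cmod z < r -> holo g z) ->
  0 < eta -> (forall z, Cmod (z - z0) < eta -> g z = 0%C) ->
  forall z, Cmod z < r -> g z = 0%C.
Proof.
intros Hz0 Hg Heta H0.
set (del := r - Cmod z0).
assert (Hdel : 0 < del) by (unfold del; lra).
assert (Hspread : forall (s : R) (e : R), 0 <= s <= 1 -> 0 < e ->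
  (forall z, Cmod (z - s * z0) < e -> g z = 0%C) ->
  forall z, Cmod (z - s * z0) < del -> g z = 0%C).
{ intros s e Hs He H.
  destruct (isolated_zeros g (s * z0)%C del) as [|[eta' [Heta' Hn]]]; auto.
  - intros z Hz; apply Hg.
    pose proof (Cmod_triangle (z - s * z0) (s * z0)) as T.
    replace (z - s * z0 + s * z0)%C with z in T by ring.
    rewrite Cmod_mult, Cmod_R, Rabs_pos_eq in T by lra.
    pose proof (Cmod_ge_0 z0); unfold del in Hz; nra.
  - exfalso; set (x := Rmin e eta' / 2).
    assert (Hx : 0 < x /\ x < e /\ x < eta').
    { pose proof (Rmin_l e eta'); pose proof (Rmin_r e eta').
      assert (0 < Rmin e eta') by (apply Rmin_pos; auto); unfold x; lra. }
    assert (Hm : Cmod (s * z0 + x - s * z0) = x).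
    { replace (s * z0 + x - s * z0)%C with (RtoC x) by ring; rewrite Cmod_R, Rabs_pos_eq; lra. }
    apply (Hn (s * z0 + x)%C); [lra|]; apply H; lra. }
destruct (INR_unbounded (Cmod z0 / del)) as [N HN].
assert (HN0 : 0 < INR N).
{ eapply Rle_lt_trans; [|exact HN]; apply Rdiv_le_0_compat; auto; apply Cmod_ge_0. }
assert (Hstep : Cmod z0 / INR N < del).
{ apply Rmult_lt_reg_r with (INR N); auto.
  apply Rmult_lt_compat_r with (r := del) in HN; auto.
  unfold Rdiv in *; rewrite Rmult_assoc, Rinv_l in * by lra; lra. }
assert (Hchain : forall k, (k <= N)%nat ->
  forall z, Cmod (z - RtoC (1 - INR k / INR N) * z0) < del -> g z = 0%C).
{ induction k as [|k IH]; intros Hk.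
  - apply (Hspread _ eta); auto; simpl; [unfold Rdiv; rewrite Rmult_0_l; lra|].
    intros z Hz; apply H0.
    replace (z - z0)%C with (z - RtoC (1 - 0 / INR N) * z0)%C; auto.
    unfold Rdiv; rewrite Rmult_0_l, Rminus_0_r; ring.
  - assert (HSk : INR (S k) / INR N <= 1).
    { apply le_INR in Hk; apply Rmult_le_reg_r with (INR N); auto.
      unfold Rdiv; rewrite Rmult_assoc, Rinv_l; lra. }
    assert (HSk0 : 0 <= INR (S k) / INR N) by (apply Rdiv_le_0_compat; auto; apply pos_INR).
    apply (Hspread _ (del - Cmod z0 / INR N)); [lra|lra|].
    intros z Hz; apply IH; [lia|].
    replace (z - RtoC (1 - INR k / INR N) * z0)%C with
      ((z - RtoC (1 - INR (S k) / INR N) * z0) + (- RtoC (/ INR N)) * z0)%C.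
    + eapply Rle_lt_trans; [apply Cmod_triangle|].
      rewrite Cmod_mult, Cmod_opp, Cmod_R, Rabs_pos_eq by (left; apply Rinv_0_lt_compat; auto).
      unfold Rdiv in Hz; lra.
    + rewrite S_INR; replace (1 - INR k / INR N) with (1 - (INR k + 1) / INR N + / INR N) by (field; lra).
      rewrite RtoC_plus; ring. }
apply (identity_theorem_real g r del); auto.
intros x Hx; apply (Hchain N); auto.
replace (1 - INR N / INR N) with 0 by (field; lra).
replace (x - 0 * z0)%C with (RtoC x) by ring; rewrite Cmod_R; exact Hx.
Qed.

(** * Quaternions and slices *)

Lemma filterdiff_affine {U V : NormedModule R_AbsRing} (f l : U -> V) (x : U) :
  is_linear l -> (forall u v, minus (f u) (f v) = l (minus u v)) -> filterdiff f (locally x) l.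
Proof.
intros Hl H; split; auto; intros y _ eps; apply filter_forall; intros u.
rewrite H, minus_eq_zero; apply Rle_trans with 0; [right; apply (norm_zero (V := V))|].
apply Rmult_le_pos; [left; apply cond_pos|apply norm_ge_0].
Qed.

Lemma filterdiff_partials (k l : C -> R) (x y : R) :
  diff_at_C k (x, y) l ->
  is_derive (fun t => k (t, y)) x (l (1, 0)) /\ is_derive (fun t => k (x, t)) y (l (0, 1)).
Proof.
intros H; pose proof (proj1 H) as Hl.
split.
- apply (filterdiff_ext_lin (K := R_AbsRing) (U := R_NormedModule) (V := R_NormedModule)
    _ (fun h => l (h, 0))).
  + apply (filterdiff_comp' (K := R_AbsRing) (U := R_NormedModule) (V := C_R_NormedModule)
      (W := R_NormedModule) (fun t => (t, y) : C) k x (fun h => (h, 0) : C) l); auto.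
    apply (filterdiff_affine (U := R_NormedModule) (V := C_R_NormedModule)).
    * apply (is_linear_prod (K := R_AbsRing) (T := R_NormedModule) (U := R_NormedModule) (V := R_NormedModule));
        
        [apply is_linear_id|apply (is_linear_zero (K := R_AbsRing) (U := R_NormedModule) (V := R_NormedModule))].
    * intros u v; apply injective_projections; simpl; [reflexivity|apply Rplus_opp_r].
  + intros h; rewrite <- (linear_scal _ Hl h (1, 0)); f_equal.
    apply injective_projections; symmetry; [apply Rmult_1_r|apply Rmult_0_r].
- apply (filterdiff_ext_lin (K := R_AbsRing) (U := R_NormedModule) (V := R_NormedModule)
    _ (fun h => l (0, h))).
  + apply (filterdiff_comp' (K := R_AbsRing) (U := R_NormedModule) (V := C_R_NormedModule)
      (W := R_NormedModule) (fun t => (x, t) : C) k y (fun h => (0, h) : C) l); auto.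
    apply (filterdiff_affine (U := R_NormedModule) (V := C_R_NormedModule)).
    * apply (is_linear_prod (K := R_AbsRing) (T := R_NormedModule) (U := R_NormedModule) (V := R_NormedModule));
        
        [apply (is_linear_zero (K := R_AbsRing) (U := R_NormedModule) (V := R_NormedModule))|apply is_linear_id].
    * intros u v; apply injective_projections; simpl; [apply Rplus_opp_r|reflexivity].
  + intros h; rewrite <- (linear_scal _ Hl h (0, 1)); f_equal.
    apply injective_projections; symmetry; [apply Rmult_0_r|apply Rmult_1_r].
Qed.

Definition dot (p q : quat) : R :=
  let '(a1, b1, c1, d1) := p in let '(a2, b2, c2, d2) := q in
  a1 * a2 + b1 * b2 + c1 * c2 + d1 * d2.

Lemma imag_unit_iff (I : quat) :
  imag_unit I <-> exists b c d, I = (0, b, c, d) /\ b * b + c * c + d * d = 1.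
Proof.
destruct I as [[[a b] c] d]; unfold imag_unit, Qmult, Qreal; split.
- intros H; injection H; intros H4 H3 H2 H1.
  assert (a = 0) by nra; subst a.
  exists b, c, d; split; [auto|nra].
- intros [b' [c' [d' [H H1]]]]; injection H; intros; subst.
  repeat f_equal; nra.
Qed.

Lemma Qplus_eq (a1 b1 c1 d1 a2 b2 c2 d2 : R) :
  plus ((a1, b1, c1, d1) : quat) (a2, b2, c2, d2) = (a1 + a2, b1 + b2, c1 + c2, d1 + d2).
Proof. reflexivity. Qed.

Lemma quat_eq (a1 b1 c1 d1 a2 b2 c2 d2 : R) :
  a1 = a2 -> b1 = b2 -> c1 = c2 -> d1 = d2 -> ((a1, b1, c1, d1) : quat) = (a2, b2, c2, d2).
Proof. intros -> -> -> ->; reflexivity. Qed.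

Lemma slice_imag (b c d x y : R) : slice (0, b, c, d) x y = (x, y * b, y * c, y * d).
Proof. unfold slice, Qreal, Qmult; rewrite Qplus_eq; apply quat_eq; ring. Qed.

Lemma Qnorm_slice (I : quat) (x y : R) : imag_unit I -> Qnorm (slice I x y) = Cmod (x, y).
Proof.
intros HI; apply imag_unit_iff in HI; destruct HI as [b [c [d [-> H]]]].
rewrite slice_imag; unfold Qnorm, Cmod; simpl fst; simpl snd; f_equal; nra.
Qed.

Lemma exists_slice (q : quat) : exists I x y, imag_unit I /\ q = slice I x y.
Proof.
destruct q as [[[a b] c] d].
set (n := sqrt (b * b + c * c + d * d)).
assert (Hn : n * n = b * b + c * c + d * d) by (apply sqrt_sqrt; nra).
destruct (Req_dec n 0) as [H0|H0].
- exists (0, 1, 0, 0), a, 0; split; [apply imag_unit_iff; exists 1, 0, 0; split; auto; lra|].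
  rewrite slice_imag, H0 in *; apply quat_eq; nra.
- exists (0, b / n, c / n, d / n), a, n; split.
  + apply imag_unit_iff; do 3 eexists; split; [reflexivity|].
    field_simplify; auto; rewrite <- Rmult_1_l; unfold Rdiv; apply Rmult_eq_reg_r with (n ^ 2).
    * rewrite Rmult_assoc, Rinv_l; [nra|]; apply pow_nonzero; auto.
    * apply pow_nonzero; auto.
  + rewrite slice_imag; apply quat_eq; field; auto.
Qed.

Notation Q_R_NormedModule := (prod_NormedModule R_AbsRing (prod_NormedModule R_AbsRing
  (prod_NormedModule R_AbsRing R_NormedModule R_NormedModule) R_NormedModule) R_NormedModule).

Lemma Qminus_eq (a1 b1 c1 d1 a2 b2 c2 d2 : R) :
  minus ((a1, b1, c1, d1) : quat) (a2, b2, c2, d2) = (a1 - a2, b1 - b2, c1 - c2, d1 - d2).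
Proof. reflexivity. Qed.

Lemma quat_inj (a1 b1 c1 d1 a2 b2 c2 d2 : R) :
  ((a1, b1, c1, d1) : quat) = (a2, b2, c2, d2) -> a1 = a2 /\ b1 = b2 /\ c1 = c2 /\ d1 = d2.
Proof. intros H; injection H; auto. Qed.

Lemma Rabs_le_Qnorm (a b c d : R) :
  Rabs a <= Qnorm (a, b, c, d) /\ Rabs b <= Qnorm (a, b, c, d) /\
  Rabs c <= Qnorm (a, b, c, d) /\ Rabs d <= Qnorm (a, b, c, d).
Proof.
unfold Qnorm; repeat split; rewrite <- sqrt_Rsqr_abs; apply sqrt_le_1_alt; unfold Rsqr; nra.
Qed.

Lemma Rabs_dot_le (a b c d : R) (q : quat) :
  Rabs (dot (a, b, c, d) q) <= (Rabs a + Rabs b + Rabs c + Rabs d + 1) * Qnorm q.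
Proof.
destruct q as [[[a1 b1] c1] d1]; unfold dot.
destruct (Rabs_le_Qnorm a1 b1 c1 d1) as (? & ? & ? & ?).
pose proof (Rabs_triang (a * a1 + b * b1 + c * c1) (d * d1)).
pose proof (Rabs_triang (a * a1 + b * b1) (c * c1)).
pose proof (Rabs_triang (a * a1) (b * b1)).
set (N := Qnorm (a1, b1, c1, d1)) in *.
assert (0 <= N) by apply sqrt_pos.
assert (Hm : forall s t, Rabs t <= N -> Rabs (s * t) <= Rabs s * N)
  by (intros; rewrite Rabs_mult; apply Rmult_le_compat_l; [apply Rabs_pos|auto]).
pose proof (Hm a a1 ltac:(auto)); pose proof (Hm b b1 ltac:(auto)).
pose proof (Hm c c1 ltac:(auto)); pose proof (Hm d d1 ltac:(auto)).
lra.
Qed.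

Lemma is_linear_dot (p : quat) :
  is_linear (K := R_AbsRing) (U := Q_R_NormedModule) (V := R_NormedModule) (dot p).
Proof.
destruct p as [[[a b] c] d]; split.
- intros [[[a1 b1] c1] d1] [[[a2 b2] c2] d2].
  change (dot (a, b, c, d) (a1 + a2, b1 + b2, c1 + c2, d1 + d2) =
    dot (a, b, c, d) (a1, b1, c1, d1) + dot (a, b, c, d) (a2, b2, c2, d2)).
  unfold dot; ring.
- intros k [[[a1 b1] c1] d1].
  change (dot (a, b, c, d) (k * a1, k * b1, k * c1, k * d1) = k * dot (a, b, c, d) (a1, b1, c1, d1)).
  unfold dot; ring.
- exists (Rabs a + Rabs b + Rabs c + Rabs d + 1).
  pose proof (Rabs_pos a); pose proof (Rabs_pos b); pose proof (Rabs_pos c); pose proof (Rabs_pos d).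
  split; [lra|]; intros q.
  change (Rabs (dot (a, b, c, d) q) <= (Rabs a + Rabs b + Rabs c + Rabs d + 1) * norm q).
  rewrite (Qnorm_norm q); apply Rabs_dot_le.
Qed.

Lemma is_linear_slice (I : quat) : imag_unit I ->
  is_linear (K := R_AbsRing) (U := C_R_NormedModule) (V := Q_R_NormedModule)
    (fun z : C => slice I (fst z) (snd z)).
Proof.
intros HI; split.
- apply imag_unit_iff in HI; destruct HI as [b [c [d [-> _]]]].
  intros [x1 y1] [x2 y2].
  change (slice (0, b, c, d) (x1 + x2) (y1 + y2) =
    plus (slice (0, b, c, d) x1 y1) (slice (0, b, c, d) x2 y2)).
  rewrite !slice_imag, Qplus_eq; apply quat_eq; ring.
- apply imag_unit_iff in HI; destruct HI as [b [c [d [-> _]]]].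
  intros k [x y].
  change (slice (0, b, c, d) (k * x) (k * y) =
    scal (V := Q_R_NormedModule) k (slice (0, b, c, d) x y)).
  rewrite !slice_imag.
  change ((k * x, k * y * b, k * y * c, k * y * d) = (k * x, k * (y * b), k * (y * c), k * (y * d))).
  apply quat_eq; ring.
- exists 1; split; [lra|]; intros [x y].
  rewrite Rmult_1_l, <- Cmod_norm; right.
  rewrite <- (Qnorm_slice I x y HI); apply Qnorm_norm.
Qed.

(** Left multiplication by an imaginary unit is skew-symmetric. *)
Lemma dot_mult_imag (I p q : quat) : imag_unit I -> dot p (Qmult I q) = - dot (Qmult I p) q.
Proof.
intros HI; apply imag_unit_iff in HI; destruct HI as [b [c [d [-> _]]]].
destruct p as [[[? ?] ?] ?], q as [[[? ?] ?] ?]; unfold dot, Qmult; ring.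
Qed.

Lemma dot_mult_imag2 (I p q : quat) : imag_unit I -> dot (Qmult I p) (Qmult I q) = dot p q.
Proof.
intros HI; apply imag_unit_iff in HI; destruct HI as [b [c [d [-> H]]]].
destruct p as [[[p0 p1] p2] p3], q as [[[q0 q1] q2] q3].
transitivity ((b * b + c * c + d * d) * dot (p0, p1, p2, p3) (q0, q1, q2, q3));
  [unfold dot, Qmult; ring|rewrite H; ring].
Qed.

Lemma dot_plus (p q1 q2 : quat) : dot p (plus q1 q2) = dot p q1 + dot p q2.
Proof.
destruct p as [[[? ?] ?] ?], q1 as [[[? ?] ?] ?], q2 as [[[? ?] ?] ?].
rewrite Qplus_eq; unfold dot; ring.
Qed.

Lemma dot_minus (p q1 q2 : quat) : dot p (minus q1 q2) = dot p q1 - dot p q2.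
Proof.
destruct p as [[[? ?] ?] ?], q1 as [[[? ?] ?] ?], q2 as [[[? ?] ?] ?].
rewrite Qminus_eq; unfold dot; ring.
Qed.

Lemma dot_real_mult (p q : quat) (t : R) : dot p (Qmult (Qreal t) q) = t * dot p q.
Proof.
destruct p as [[[? ?] ?] ?], q as [[[? ?] ?] ?]; unfold dot, Qmult, Qreal; ring.
Qed.

Lemma dot_ext (q1 q2 : quat) : (forall p, dot p q1 = dot p q2) -> q1 = q2.
Proof.
destruct q1 as [[[a1 b1] c1] d1], q2 as [[[a2 b2] c2] d2]; intros H.
pose proof (H (1, 0, 0, 0)); pose proof (H (0, 1, 0, 0)).
pose proof (H (0, 0, 1, 0)); pose proof (H (0, 0, 0, 1)); unfold dot in *.
apply quat_eq; lra.
Qed.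

(** * Holomorphic components and the stem of a regular function *)

(** The pairing of [f] with [p] on the slice of [I], for the complex structure given by left
    multiplication by [I]: replacing [f] by [I f] multiplies the pair by [Ci].  The equation in the
    definition of regular functions thus becomes the Cauchy-Riemann equation. *)
Definition slice_comp (f : quat -> quat) (I p : quat) (z : C) : C :=
  (dot p (f (slice I (fst z) (snd z))), dot (Qmult I p) (f (slice I (fst z) (snd z)))).

Lemma slice_comp_holo (Om : quat -> Prop) (f : quat -> quat) (I p : quat) (z : C) :
  regular Om f -> imag_unit I -> Om (slice I (fst z) (snd z)) -> holo (slice_comp f I p) z.
Proof.
intros [Hd HCR] HI HOm; destruct z as [x y]; simpl in HOm.
destruct (Hd _ HOm) as [lf Hlf].
assert (Hk : forall q, diff_at_C (fun z : C => dot q (f (slice I (fst z) (snd z)))) (x, y)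
   (fun h : C => dot q (lf (slice I (fst h) (snd h))))).
{ intros q.
  apply (filterdiff_comp' (K := R_AbsRing) (U := C_R_NormedModule) (V := Q_R_NormedModule)
    (W := R_NormedModule) (fun z : C => f (slice I (fst z) (snd z))) (dot q) (x, y)
    (fun h : C => lf (slice I (fst h) (snd h))) (dot q)).
  - apply (filterdiff_comp' (K := R_AbsRing) (U := C_R_NormedModule) (V := Q_R_NormedModule)
      (W := Q_R_NormedModule) (fun z : C => slice I (fst z) (snd z)) f (x, y)
      (fun h : C => slice I (fst h) (snd h)) lf); auto.
    apply (filterdiff_linear (K := R_AbsRing) (U := C_R_NormedModule) (V := Q_R_NormedModule)), is_linear_slice; auto.
  - apply (filterdiff_linear (K := R_AbsRing) (U := Q_R_NormedModule) (V := R_NormedModule)), is_linear_dot. }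
destruct (HCR I HI x y HOm) as [fx [fy [Hx [Hy E]]]].
assert (Hdot : forall q (g : R -> quat) t l, is_derive g t l -> is_derive (fun s => dot q (g s)) t (dot q l)).
{ intros q g t l Hg.
  apply (filterdiff_ext_lin (K := R_AbsRing) (U := R_NormedModule) (V := R_NormedModule)
    _ (fun s => dot q (scal (V := Q_R_NormedModule) s l))).
  - apply (filterdiff_comp' (K := R_AbsRing) (U := R_NormedModule) (V := Q_R_NormedModule)
      (W := R_NormedModule) g (dot q) t (fun s => scal (V := Q_R_NormedModule) s l) (dot q)); [exact Hg|].
    apply (filterdiff_linear (K := R_AbsRing) (U := Q_R_NormedModule) (V := R_NormedModule)), is_linear_dot.
  - intros s; apply (linear_scal _ (is_linear_dot q)). }
assert (Ex : forall q, dot q (lf (slice I 1 0)) = dot q fx).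
{ intros q; destruct (filterdiff_partials _ _ _ _ (Hk q)) as [P _].
  apply is_derive_unique in P; simpl in P; rewrite <- P.
  apply is_derive_unique; apply Hdot; exact Hx. }
assert (Ey : forall q, dot q (lf (slice I 0 1)) = dot q fy).
{ intros q; destruct (filterdiff_partials _ _ _ _ (Hk q)) as [_ P].
  apply is_derive_unique in P; simpl in P; rewrite <- P.
  apply is_derive_unique; apply Hdot; exact Hy. }
assert (EI : forall q, dot q fx = dot (Qmult I q) fy).
{ intros q; apply (f_equal (dot q)) in E.
  rewrite dot_real_mult, dot_plus, dot_mult_imag in E by auto.
  destruct q as [[[? ?] ?] ?]; unfold Qreal in E; simpl in E; simpl; lra. }
apply (holo_of_cauchy_riemann _ _ _ _ _ (Hk p) (Hk (Qmult I p))); simpl; rewrite Ex, Ey.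
- apply EI.
- rewrite EI; clear -HI; apply imag_unit_iff in HI; destruct HI as [b [c [d [-> H]]]].
  destruct p as [[[p0 p1] p2] p3], fy as [[[q0 q1] q2] q3].
  transitivity ((b * b + c * c + d * d) * dot (p0, p1, p2, p3) (q0, q1, q2, q3));
    [rewrite H; ring|unfold dot, Qmult; ring].
Qed.

Definition Qi : quat := (0, 1, 0, 0).

Lemma imag_unit_Qi : imag_unit Qi.
Proof. apply imag_unit_iff; exists 1, 0, 0; split; auto; lra. Qed.

(** With [stem_im], the unique pair for which the representation [f (x + y I) = b + I c] holds
    for the two units [I = Qi] and [I = - Qi]; the point is that it then holds for all units. *)
Definition stem_re (f : quat -> quat) (z : C) : quat :=
  Qmult (Qreal (1 / 2)) (plus (f (slice Qi (fst z) (snd z))) (f (slice Qi (fst z) (- snd z)))).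

Definition stem_im (f : quat -> quat) (z : C) : quat :=
  Qmult Qi (Qmult (Qreal (1 / 2)) (minus (f (slice Qi (fst z) (- snd z))) (f (slice Qi (fst z) (snd z))))).

(** A component of the stem function [stem_re f + i stem_im f], which takes values in the
    complexified quaternions. *)
Definition stem (f : quat -> quat) (p : quat) (z : C) : C := (dot p (stem_re f z), dot p (stem_im f z)).

Lemma holo_conj (g : C -> C) (z : C) : holo g (Cconj z) -> holo (fun u => Cconj (g (Cconj u))) z.
Proof.
intros [d Hd]; exists (Cconj d); apply is_Cderive_Cmod; intros eps Heps.
destruct (proj1 (is_Cderive_Cmod _ _ _) Hd eps Heps) as [del [Hdel H]].
exists del; split; auto; intros u Hu.
assert (E : Cmod (Cconj u - Cconj z) = Cmod (u - z)) by (rewrite <- Cminus_conj; apply Cmod_conj).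
rewrite <- E in Hu; specialize (H _ Hu); rewrite E in H.
replace (Cconj (g (Cconj u)) - Cconj (g (Cconj z)) - Cconj d * (u - z))%C with
  (Cconj (g (Cconj u) - g (Cconj z) - d * (Cconj u - Cconj z))).
- rewrite Cmod_conj; exact H.
- rewrite !Cminus_conj, Cmult_conj, Cminus_conj, !Cconj_conj; reflexivity.
Qed.

Section Stem.
Variables (r : R) (f : quat -> quat).
Hypothesis hf : regular (Qball0 r) f.

Lemma slice_comp_holo_ball I p z : imag_unit I -> Cmod z < r -> holo (slice_comp f I p) z.
Proof.
intros HI Hz; apply (slice_comp_holo (Qball0 r)); auto.
unfold Qball0; rewrite Qnorm_slice by auto; destruct z; exact Hz.
Qed.

(** The stem is the symmetrisation of a slice component under conjugation. *)
Lemma stem_holo p z : Cmod z < r -> holo (stem f p) z.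
Proof.
intros Hz.
apply (holo_ext_loc (fun u => RtoC (1 / 2) * (slice_comp f Qi p u + Cconj (slice_comp f Qi p (Cconj u))))%C).
- apply filter_forall; intros [x y].
  unfold stem, stem_re, stem_im, slice_comp; simpl fst; simpl snd.
  rewrite (dot_mult_imag Qi), !dot_real_mult, dot_plus, dot_minus by apply imag_unit_Qi.
  apply injective_projections; simpl; field.
- apply holo_scal, holo_plus; [apply slice_comp_holo_ball; auto using imag_unit_Qi|].
  apply holo_conj, slice_comp_holo_ball; [apply imag_unit_Qi|rewrite Cmod_conj; auto].
Qed.

Lemma slice_real (I J : quat) (x : R) : imag_unit I -> imag_unit J -> slice I x 0 = slice J x 0.
Proof.
intros HI HJ; apply imag_unit_iff in HI; destruct HI as [b [c [d [-> _]]]].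
apply imag_unit_iff in HJ; destruct HJ as [b' [c' [d' [-> _]]]].
rewrite !slice_imag; apply quat_eq; ring.
Qed.

Lemma stem_real p x I : imag_unit I -> stem f p (RtoC x) = RtoC (dot p (f (slice I x 0))).
Proof.
intros HI; rewrite (slice_real I Qi x HI imag_unit_Qi).
unfold stem, stem_re, stem_im; simpl fst; simpl snd; rewrite Ropp_0.
rewrite (dot_mult_imag Qi), !dot_real_mult, dot_plus, dot_minus by apply imag_unit_Qi.
apply injective_projections; simpl; field.
Qed.

(** Both sides, paired with [p] in the sense of [slice_comp], are holomorphic on the slice of [I]
    and agree on the real axis, where the choice of [I] is irrelevant. *)
Lemma representation I z : imag_unit I -> Cmod z < r ->
  f (slice I (fst z) (snd z)) = plus (stem_re f z) (Qmult I (stem_im f z)).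
Proof.
intros HI Hz; apply dot_ext; intros p.
assert (Hr : 0 < r) by (pose proof (Cmod_ge_0 z); lra).
assert (H : (slice_comp f I p z - (stem f p z + Ci * stem f (Qmult I p) z))%C = 0%C).
{ apply (identity_theorem_real (fun z => slice_comp f I p z - (stem f p z + Ci * stem f (Qmult I p) z))%C r r); auto.
  - intros u Hu; apply holo_minus; [apply slice_comp_holo_ball; auto|].
    apply holo_plus, holo_scal; apply stem_holo; auto.
  - intros x Hx; rewrite !(stem_real _ x I HI); unfold slice_comp; simpl fst; simpl snd.
    apply injective_projections; simpl; ring. }
apply (f_equal fst) in H; rewrite dot_plus, (dot_mult_imag I) by auto.
unfold slice_comp, stem in H; simpl in H; lra.
Qed.
End Stem.

(** * Values taken on a sphere *)

Definition Qone : quat := (1, 0, 0, 0).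
Definition Qj : quat := (0, 0, 1, 0).
Definition Qk : quat := (0, 0, 0, 1).

(** The norm [sum of (F_m - w_m)^2] of the stem minus [w], extended to complex coordinates
    as a polynomial, hence without conjugation, so that it depends holomorphically on [z]. *)
Definition stem_norm (f : quat -> quat) (w : quat) (z : C) : C :=
  let sq p := ((stem f p z - RtoC (dot p w)) * (stem f p z - RtoC (dot p w)))%C in
  (sq Qone + sq Qi + sq Qj + sq Qk)%C.

Lemma stem_norm_eq (f : quat -> quat) (w : quat) (z : C) :
  let b := minus (stem_re f z) w in let c := stem_im f z in
  stem_norm f w z = (dot b b - dot c c, 2 * dot b c).
Proof.
unfold stem_norm, stem; generalize (stem_re f z) (stem_im f z).
intros [[[b0 b1] b2] b3] [[[c0 c1] c2] c3]; destruct w as [[[w0 w1] w2] w3].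
rewrite Qminus_eq; unfold dot, Qone, Qi, Qj, Qk.
apply injective_projections; simpl; ring.
Qed.

(** [b = - I c] has the length of [c] and is orthogonal to it. *)
Lemma null_pair_of_unit (I b c : quat) :
  imag_unit I -> plus b (Qmult I c) = Qreal 0 -> dot b b = dot c c /\ dot b c = 0.
Proof.
intros HI H.
assert (Hp : forall p, dot p b = dot (Qmult I p) c).
{ intros p; apply (f_equal (dot p)) in H; rewrite dot_plus, dot_mult_imag in H by auto.
  destruct p as [[[? ?] ?] ?]; unfold Qreal in H; simpl in H; simpl; lra. }
assert (Hb : dot b b = dot (Qmult I b) c) by apply Hp.
assert (Hcc : dot (Qmult I c) b = - dot c c).
{ rewrite Hp; rewrite <- (Ropp_involutive (dot (Qmult I (Qmult I c)) c)).
  rewrite <- dot_mult_imag, dot_mult_imag2 by auto; reflexivity. }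
assert (Hsym : forall p q, dot p q = dot q p).
{ intros [[[? ?] ?] ?] [[[? ?] ?] ?]; unfold dot; ring. }
pose proof (Hp c) as Hc; pose proof (dot_mult_imag I c b HI) as E1.
rewrite (Hsym c (Qmult I b)), Hcc in E1.
pose proof (dot_mult_imag I c c HI) as E2; rewrite (Hsym c (Qmult I c)) in E2.
rewrite (Hsym b c); split; lra.
Qed.

(** Unless both vanish, the unit is [- b c^-1].  Its real part is a multiple of [dot b c], and its norm is 1, by the
    multiplicativity of the quaternion norm. *)
Lemma unit_of_null_pair (b c : quat) :
  dot b b = dot c c -> dot b c = 0 ->
  exists I, imag_unit I /\ plus b (Qmult I c) = Qreal 0.
Proof.
destruct b as [[[b0 b1] b2] b3], c as [[[c0 c1] c2] c3].
set (n := dot (c0, c1, c2, c3) (c0, c1, c2, c3)); intros Hn H0.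
unfold dot in Hn, H0.
assert (En : n = c0 * c0 + c1 * c1 + c2 * c2 + c3 * c3) by reflexivity.
destruct (Req_dec n 0) as [Hz|Hz].
- exists Qi; split; [apply imag_unit_Qi|].
  assert (Hsq : forall x0 x1 x2 x3, x0 * x0 + x1 * x1 + x2 * x2 + x3 * x3 = 0 ->
    x0 = 0 /\ x1 = 0 /\ x2 = 0 /\ x3 = 0) by (intros x0 x1 x2 x3 Hx;
      pose proof (Rle_0_sqr x0); pose proof (Rle_0_sqr x1);
      pose proof (Rle_0_sqr x2); pose proof (Rle_0_sqr x3);
      unfold Rsqr in *; repeat split; apply Rsqr_0_uniq; unfold Rsqr; lra).
  rewrite Hz in Hn, En; symmetry in En.
  destruct (Hsq _ _ _ _ Hn) as (-> & -> & -> & ->).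
  destruct (Hsq _ _ _ _ En) as (-> & -> & -> & ->).
  unfold Qmult, Qi, Qreal; rewrite Qplus_eq; apply quat_eq; ring.
  (* imaginary part of [b] times the conjugate of [c] *)
- set (p1 := - b0 * c1 + b1 * c0 - b2 * c3 + b3 * c2).
  set (p2 := - b0 * c2 + b1 * c3 + b2 * c0 - b3 * c1).
  set (p3 := - b0 * c3 - b1 * c2 + b2 * c1 + b3 * c0).
  exists (0, - p1 / n, - p2 / n, - p3 / n); split.
  + apply imag_unit_iff; do 3 eexists; split; [reflexivity|].
    assert (P : p1 * p1 + p2 * p2 + p3 * p3 = n * n).
    { transitivity ((b0 * b0 + b1 * b1 + b2 * b2 + b3 * b3) * (c0 * c0 + c1 * c1 + c2 * c2 + c3 * c3)
        - (b0 * c0 + b1 * c1 + b2 * c2 + b3 * c3) * (b0 * c0 + b1 * c1 + b2 * c2 + b3 * c3));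
        [unfold p1, p2, p3; ring|rewrite H0, Hn, <- En; ring]. }
    transitivity ((p1 * p1 + p2 * p2 + p3 * p3) / (n * n)); [field; auto|rewrite P; field; auto].
  + unfold Qmult, Qreal; rewrite Qplus_eq.
    set (s := b0 * c0 + b1 * c1 + b2 * c2 + b3 * c3) in H0.
    assert (Hq : forall x y, x * n + y = 0 -> x + y / n = 0).
    { intros x y Hxy; apply Rmult_eq_reg_r with n; auto.
      rewrite Rmult_0_l, <- Hxy; field; auto. }
    apply quat_eq.
    * transitivity (b0 + (p1 * c1 + p2 * c2 + p3 * c3) / n); [field; auto|apply Hq].
      transitivity (c0 * s); [rewrite En; unfold p1, p2, p3, s; ring|rewrite H0; ring].
    * transitivity (b1 + (- p1 * c0 - p2 * c3 + p3 * c2) / n); [field; auto|apply Hq].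
      transitivity (c1 * s); [rewrite En; unfold p1, p2, p3, s; ring|rewrite H0; ring].
    * transitivity (b2 + (p1 * c3 - p2 * c0 - p3 * c1) / n); [field; auto|apply Hq].
      transitivity (c2 * s); [rewrite En; unfold p1, p2, p3, s; ring|rewrite H0; ring].
    * transitivity (b3 + (- p1 * c2 + p2 * c1 - p3 * c0) / n); [field; auto|apply Hq].
      transitivity (c3 * s); [rewrite En; unfold p1, p2, p3, s; ring|rewrite H0; ring].
Qed.

(** By the representation formula, [f] takes the value [w] at the unit [I] if and only if
    [b - w = - I c] for the stem [(b, c)]; the existence of such a unit amounts to the two real
    equations that the real and imaginary parts of [stem_norm] express.  The unit cannot be
    prescribed, which is why whole spheres, hence circular sets, come in. *)
Lemma stem_norm_eq_0 (r : R) (f : quat -> quat) (w : quat) (z : C) :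
  regular (Qball0 r) f -> Cmod z < r ->
  stem_norm f w z = 0%C <-> exists I, imag_unit I /\ f (slice I (fst z) (snd z)) = w.
Proof.
intros hf Hz; rewrite stem_norm_eq; cbv zeta.
assert (Hw : forall I, imag_unit I -> f (slice I (fst z) (snd z)) = w <->
   plus (minus (stem_re f z) w) (Qmult I (stem_im f z)) = Qreal 0).
{ intros I HI; rewrite (representation r f hf I z HI Hz).
  generalize (stem_re f z) (Qmult I (stem_im f z)); destruct w as [[[? ?] ?] ?].
  intros [[[? ?] ?] ?] [[[? ?] ?] ?]; unfold Qreal; rewrite Qminus_eq, !Qplus_eq.
  split; intros H; apply quat_inj in H; destruct H as (? & ? & ? & ?); apply quat_eq; lra. }
split.
- generalize (minus (stem_re f z) w) (stem_im f z) Hw; clear Hw; intros b c Hw H.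
  pose proof (f_equal fst H) as H1; pose proof (f_equal snd H) as H2; simpl fst in H1; simpl snd in H2.
  destruct (unit_of_null_pair b c) as [I [HI E]]; [lra|lra|].
  exists I; split; auto; apply Hw; auto.
- intros [I [HI E]]; apply Hw in E; auto.
  destruct (null_pair_of_unit _ _ _ HI E) as [E1 E2].
  rewrite E1, E2; apply injective_projections; simpl; ring.
Qed.

(** * The open mapping theorem *)

Lemma stem_norm_holo (r : R) (f : quat -> quat) (w : quat) (z : C) :
  regular (Qball0 r) f -> Cmod z < r -> holo (stem_norm f w) z.
Proof.
intros hf Hz; unfold stem_norm; cbv zeta.
assert (H : forall p, holo (fun z => (stem f p z - RtoC (dot p w)) * (stem f p z - RtoC (dot p w)))%C z).
{ intros p; apply holo_mult; (apply holo_minus; [apply (stem_holo r); auto|apply holo_const]). }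
do 3 (apply holo_plus; [|apply H]); apply H.
Qed.

(** [slice I x y = slice (- I) x (- y)] reduces to positive [y]. *)
Lemma circular_slice (U : quat -> Prop) (I J : quat) (x y : R) :
  circular U -> imag_unit I -> imag_unit J -> U (slice I x y) -> U (slice J x y).
Proof.
intros Hc HI HJ HU.
destruct (Rtotal_order y 0) as [Hy|[->|Hy]]; [|rewrite (slice_real J I); auto|apply (Hc x y I); auto].
assert (Hopp : forall K, imag_unit K -> exists K', imag_unit K' /\ forall t, slice K x t = slice K' x (- t)).
{ intros K HK; apply imag_unit_iff in HK; destruct HK as [b [c [d [-> H]]]].
  exists (0, - b, - c, - d); split; [apply imag_unit_iff; do 3 eexists; split; [reflexivity|lra]|].
  intros t; rewrite !slice_imag; apply quat_eq; ring. }
destruct (Hopp I HI) as [I' [HI' EI]]; destruct (Hopp J HJ) as [J' [HJ' EJ]].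
rewrite EI in HU; rewrite EJ; apply (Hc x (- y) I'); auto; lra.
Qed.

(** If it vanished near [z0] it would vanish on the whole disc, in particular at real points,
    whose spheres are single points: there [f] is equal to [w].  So the stem is constant on
    the real axis, hence everywhere, and [f] is constant. *)
Lemma stem_norm_nonzero (r : R) (f : quat -> quat) (w : quat) (z0 : C) (eta : R) :
  regular (Qball0 r) f -> nonconstant_on (Qball0 r) f -> Cmod z0 < r -> 0 < eta ->
  ~ (forall z, Cmod (z - z0) < eta -> stem_norm f w z = 0%C).
Proof.
intros hf hnc Hz0 Heta H0.
assert (Hr : 0 < r) by (pose proof (Cmod_ge_0 z0); lra).
assert (Hall : forall z, Cmod z < r -> stem_norm f w z = 0%C).
{ apply (identity_theorem _ r z0 eta); auto; intros; apply (stem_norm_holo r); auto. }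
assert (Hreal : forall x I, imag_unit I -> Rabs x < r -> f (slice I x 0) = w).
{ intros x I HI Hx; assert (Hx' : Cmod (RtoC x) < r) by (rewrite Cmod_R; auto).
  destruct (proj1 (stem_norm_eq_0 r f w (RtoC x) hf Hx') (Hall _ Hx')) as [J [HJ E]].
  rewrite (slice_real I J); auto. }
assert (Hstem : forall p z, Cmod z < r -> stem f p z = RtoC (dot p w)).
{ intros p z Hz.
  assert (E : (stem f p z - RtoC (dot p w))%C = 0%C).
  { apply (identity_theorem_real (fun z => stem f p z - RtoC (dot p w))%C r r); auto.
    - intros u Hu; apply holo_minus; [apply (stem_holo r); auto|apply holo_const].
    - intros x Hx; rewrite (stem_real f p x Qi imag_unit_Qi), Hreal; auto using imag_unit_Qi; ring. }
  replace (stem f p z) with (stem f p z - RtoC (dot p w) + RtoC (dot p w))%C by ring.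
  rewrite E; ring. }
assert (Hconst : forall q, Qball0 r q -> f q = w).
{ intros q Hq; destruct (exists_slice q) as [I [x [y [HI ->]]]].
  unfold Qball0 in Hq; rewrite Qnorm_slice in Hq by auto.
  pose proof (representation r f hf I (x, y) HI Hq) as E; simpl fst in E; simpl snd in E; rewrite E.
  apply dot_ext; intros p; rewrite dot_plus, (dot_mult_imag I) by auto.
  pose proof (f_equal fst (Hstem p (x, y) Hq)) as E1.
  pose proof (f_equal snd (Hstem (Qmult I p) (x, y) Hq)) as E2.
  unfold stem in E1, E2; simpl in E1, E2; lra. }
destruct hnc as [p [q [Hp [Hq Hpq]]]]; apply Hpq; rewrite !Hconst; auto.
Qed.

Lemma dot_basis_close (w0 w : quat) (e : R) (p : quat) :
  ball w0 e w -> p = Qone \/ p = Qi \/ p = Qj \/ p = Qk -> Rabs (dot p w - dot p w0) <= e.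
Proof.
destruct w0 as [[[a0 b0] c0] d0], w as [[[a b] c] d].
intros [[[Ha Hb] Hc] Hd] Hp; simpl in Ha, Hb, Hc, Hd.
assert (Hab : forall s t, ball s e t -> Rabs (t - s) <= e) by (intros s t H; left; exact H).
destruct Hp as [->|[->|[->| ->]]]; unfold Qone, Qi, Qj, Qk, dot.
- replace (_ - _) with (a - a0) by ring; apply Hab; auto.
- replace (_ - _) with (b - b0) by ring; apply Hab; auto.
- replace (_ - _) with (c - c0) by ring; apply Hab; auto.
- replace (_ - _) with (d - d0) by ring; apply Hab; auto.
Qed.

(** With [u = w - w0], each square changes by [u (u - 2 (F - w0))]. *)
Lemma stem_norm_perturb (f : quat -> quat) (w0 w : quat) (z : C) (M e : R) :
  e <= 1 -> ball w0 e w ->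
  (forall p, p = Qone \/ p = Qi \/ p = Qj \/ p = Qk -> Cmod (stem f p z - RtoC (dot p w0)) <= M) ->
  Cmod (stem_norm f w z - stem_norm f w0 z) <= 4 * (e * (2 * M + 1)).
Proof.
intros He Hw HM.
set (D p := ((stem f p z - RtoC (dot p w)) * (stem f p z - RtoC (dot p w)) -
  (stem f p z - RtoC (dot p w0)) * (stem f p z - RtoC (dot p w0)))%C).
assert (HD : forall p, p = Qone \/ p = Qi \/ p = Qj \/ p = Qk -> Cmod (D p) <= e * (2 * M + 1)).
{ intros p Hp; pose proof (dot_basis_close w0 w e p Hw Hp) as Hd; specialize (HM p Hp).
  replace (D p) with (RtoC (dot p w - dot p w0) *
    (RtoC (dot p w - dot p w0) + - (2 * (stem f p z - RtoC (dot p w0)))))%C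
    by (unfold D; rewrite RtoC_minus; ring).
  rewrite Cmod_mult, Cmod_R.
  pose proof (Cmod_triangle (RtoC (dot p w - dot p w0)) (- (2 * (stem f p z - RtoC (dot p w0))))) as T.
  rewrite Cmod_opp, Cmod_mult, !Cmod_R, (Rabs_pos_eq 2) in T by lra.
  pose proof (Rabs_pos (dot p w - dot p w0)).
  apply Rmult_le_compat; auto; [apply Cmod_ge_0|lra]. }
replace (stem_norm f w z - stem_norm f w0 z)%C with (D Qone + D Qi + D Qj + D Qk)%C
  by (unfold stem_norm, D; ring).
pose proof (Cmod_triangle (D Qone + D Qi + D Qj) (D Qk)).
pose proof (Cmod_triangle (D Qone + D Qi) (D Qj)).
pose proof (Cmod_triangle (D Qone) (D Qi)).
pose proof (HD Qone ltac:(auto)); pose proof (HD Qi ltac:(auto)).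
pose proof (HD Qj ltac:(auto)); pose proof (HD Qk ltac:(auto)).
lra.
Qed.

Theorem theorem6p5 (r : R) (f : quat -> quat) (U : quat -> Prop)
  (hf : regular (Qball0 r) f)
  (hnc : nonconstant_on (Qball0 r) f)
  (hUr : forall q : quat, U q -> Qball0 r q)
  (hUo : open U)
  (hUc : circular U) :
  open (image f U).
Proof.
intros w0 [q0 [Hq0 Hfq0]].
destruct (exists_slice q0) as [I0 [x0 [y0 [HI0 ->]]]].
set (z0 := (x0, y0) : C).
assert (HU : exists d, 0 < d /\ forall z, Cmod (z - z0) < d ->
  forall J, imag_unit J -> U (slice J (fst z) (snd z))).
{ assert (HUI : locally z0 (fun z : C => U (slice I0 (fst z) (snd z)))).
  { apply (linear_cont (K := R_AbsRing) (U := C_R_NormedModule) (V := Q_R_NormedModule)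
      (fun z : C => slice I0 (fst z) (snd z)) z0); [apply is_linear_slice; auto|].
    apply hUo; exact Hq0. }
  apply locally_Cmod in HUI; destruct HUI as [d [Hd HUd]].
  exists d; split; auto; intros z Hz J HJ; apply (circular_slice U I0); auto. }
destruct HU as [d [Hd HU]].
assert (Hdisc : forall z, Cmod (z - z0) < d -> Cmod z < r).
{ intros z Hz; specialize (HU z Hz I0 HI0); apply hUr in HU; unfold Qball0 in HU.
  rewrite Qnorm_slice in HU by auto; destruct z; exact HU. }
assert (Hzz : Cmod (z0 - z0) = 0) by (replace (z0 - z0)%C with (RtoC 0) by ring; apply Cmod_0).
assert (Hz0 : Cmod z0 < r) by (apply Hdisc; lra).
assert (HN0 : stem_norm f w0 z0 = 0%C) by (apply (stem_norm_eq_0 r); eauto).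
destruct (isolated_zeros (stem_norm f w0) z0 d) as [Hall|[eta [Heta Hiso]]].
{ intros z Hz; apply (stem_norm_holo r); auto. }
{ exfalso; apply (stem_norm_nonzero r f w0 z0 d); auto. }
(* a circle around [z0] without zeros, inside the disc whose spheres lie in [U] *)
set (rho := Rmin d eta / 2).
assert (Hrho : 0 < rho /\ rho < d /\ rho < eta).
{ pose proof (Rmin_l d eta); pose proof (Rmin_r d eta).
  assert (0 < Rmin d eta) by (apply Rmin_pos; auto); unfold rho; lra. }
assert (Hshift : forall z, (z0 + z - z0)%C = z) by (intros; ring).
assert (Hcirc : forall g : C -> C, (forall z, Cmod z < r -> holo g z) ->
  exists m M, (forall z, Cmod (z - z0) = rho -> m <= Cmod (g z) <= M) /\
    exists z, Cmod (z - z0) = rho /\ Cmod (g z) = m).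
{ intros g Hg.
  destruct (bounded_on_circle (fun u => g (z0 + u)%C) rho) as [m [M [HM [zm [Hzm Em]]]]]; [lra| |].
  - intros z Hz; apply holo_continuous, translate_holo, Hg, Hdisc; rewrite Hshift; lra.
  - exists m, M; split.
    + intros z Hz; replace z with (z0 + (z - z0))%C by ring; auto.
    + exists (z0 + zm)%C; rewrite Hshift; auto. }
destruct (Hcirc (stem_norm f w0)) as [m [M0 [HmM [zm [Hzm Em]]]]].
{ intros z Hz; apply (stem_norm_holo r); auto. }
assert (Hm : 0 < m).
{ rewrite <- Em; apply Cmod_gt_0, Hiso; lra. }
assert (HB : exists B, 0 <= B /\ forall p, p = Qone \/ p = Qi \/ p = Qj \/ p = Qk ->
  forall z, z = z0 \/ Cmod (z - z0) = rho -> Cmod (stem f p z - RtoC (dot p w0)) <= B).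
{ assert (HB1 : forall p, exists B, forall z, z = z0 \/ Cmod (z - z0) = rho ->
    Cmod (stem f p z - RtoC (dot p w0)) <= B).
  { intros p; destruct (Hcirc (fun z => stem f p z - RtoC (dot p w0))%C) as [m' [M' [HM' _]]].
    - intros z Hz; apply holo_minus; [apply (stem_holo r); auto|apply holo_const].
    - exists (Rmax M' (Cmod (stem f p z0 - RtoC (dot p w0)))); intros z [->|Hz]; [apply Rmax_r|].
      eapply Rle_trans; [apply HM'; auto|apply Rmax_l]. }
  destruct (HB1 Qone) as [B1 H1]; destruct (HB1 Qi) as [B2 H2].
  destruct (HB1 Qj) as [B3 H3]; destruct (HB1 Qk) as [B4 H4].
  exists (Rabs B1 + Rabs B2 + Rabs B3 + Rabs B4).
  pose proof (Rle_abs B1); pose proof (Rle_abs B2); pose proof (Rle_abs B3); pose proof (Rle_abs B4).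
  pose proof (Rabs_pos B1); pose proof (Rabs_pos B2); pose proof (Rabs_pos B3); pose proof (Rabs_pos B4).
  split; [lra|].
  intros p [->|[->|[->| ->]]] z Hz; [specialize (H1 z Hz)|specialize (H2 z Hz)|specialize (H3 z Hz)|specialize (H4 z Hz)]; lra. }
destruct HB as [B [HB0 HB]].
(* makes the change of [stem_norm] at [z0] and on the circle at most [m / 4] *)
set (e := Rmin 1 (m / (16 * (2 * B + 1)))).
assert (He : 0 < e /\ e <= 1 /\ 4 * (e * (2 * B + 1)) <= m / 4).
{ unfold e; split; [apply Rmin_pos; [lra|apply Rdiv_lt_0_compat; lra]|split; [apply Rmin_l|]].
  pose proof (Rmin_r 1 (m / (16 * (2 * B + 1)))) as Hr.
  apply Rmult_le_compat_r with (r := 2 * B + 1) in Hr; [|lra].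
  replace (m / (16 * (2 * B + 1)) * (2 * B + 1)) with (m / 16) in Hr by (field; lra); lra. }
destruct He as [He [He1 Hem]].
exists (mkposreal e He); intros w Hw.
assert (Hpert : forall z, z = z0 \/ Cmod (z - z0) = rho ->
  Cmod (stem_norm f w z - stem_norm f w0 z) <= m / 4).
{ intros z Hz; eapply Rle_trans; [apply stem_norm_perturb with (M := B) (e := e); auto|auto]. }
destruct (minimum_modulus (stem_norm f w) z0 rho (m / 2)) as [z [Hz E]]; [lra| | | |].
- intros z Hz; apply (stem_norm_holo r); auto; apply Hdisc; lra.
- intros z Hz; specialize (Hpert z (or_intror Hz)); destruct (HmM z Hz) as [Hmz _].
  pose proof (Cmod_minus_ge (stem_norm f w0 z) (stem_norm f w0 z - stem_norm f w z)) as T.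
  replace (stem_norm f w0 z - (stem_norm f w0 z - stem_norm f w z))%C with (stem_norm f w z) in T by ring.
  rewrite <- Cmod_opp in Hpert.
  replace (- (stem_norm f w z - stem_norm f w0 z))%C with (stem_norm f w0 z - stem_norm f w z)%C in Hpert by ring.
  lra.
- specialize (Hpert z0 (or_introl eq_refl)); rewrite HN0 in Hpert.
  replace (stem_norm f w z0 - 0)%C with (stem_norm f w z0) in Hpert by ring; lra.
- assert (Hzd : Cmod (z - z0) < d) by lra.
  apply (stem_norm_eq_0 r) in E; auto; destruct E as [J [HJ EJ]].
  exists (slice J (fst z) (snd z)); split; auto.
Qed.
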